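(* Let $P$ and $H$ be packaged arrow presentations, let $e$ be a fixed edge of $H$, and for each edge $f$ of $P$ let $\varphi_f$ be a coupling of $f$ and $e$, with $\boldsymbol\varphi=\{\varphi_f\}_{f\in E(P)}$. Let $\phi_{(=,2)},\phi_{(\parallel,2)},\phi_{\times},\phi_{(=,1)},\phi_{(\parallel,1)}$ be the unique solution of \[\alpha\beta\gamma\begin{bmatrix}\alpha\beta&1&1&\alpha&1\\1&\alpha\gamma&1&1&\alpha\\1&1&\alpha&1&1\\\alpha&1&1&\alpha&1\\1&\alpha&1&1&\alpha\end{bmatrix}\begin{bmatrix}\phi_{(=,2)}\\\phi_{(\parallel,2)}\\\phi_{\times}\\\phi_{(=,1)}\\\phi_{(\parallel,1)}\end{bmatrix}=\begin{bmatrix}Q(H\setminus e;a,b,c,x,y,\alpha,\beta,\gamma)\\Q(H/e;a,b,c,x,y,\alpha,\beta,\gamma)\\Q(H\dagger e;a,b,c,x,y,\alpha,\beta,\gamma)\\Q(H\setminus_m e;a,b,c,x,y,\alpha,\beta,\gamma)\\Q(H/_m e;a,b,c,x,y,\alpha,\beta,\gamma)\end{bmatrix}.\] Then \[Q(P\otimes_{\boldsymbol\varphi}H;a,b,c,x,y,\alpha,\beta,\gamma)=Q(P;\phi_{(=,2)},\phi_{(\parallel,2)},\phi_{\times},\phi_{(=,1)},\phi_{(\parallel,1)},\alpha,\beta,\gamma).\]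
   Context: An arrow presentation $A$ consists of a finite set $V(A)$ of disjoint circles (the vertices), a finite set of pairwise disjoint arrows (directed arcs) on the circles, and a finite set $E(A)$ of labels (the edges) such that every arrow carries one label and every label is carried by exactly two arrows (constituting that edge). An arrow along a circle from $p$ to $q$ is written $\overrightarrow{pq}$. Arrow presentations are considered up to equivalence (diffeomorphism of circles sending arrows to arrows, reversing both arrows of some edges, relabelling edges bijectively). Boundary components: for every edge $e$ with arrows $\overrightarrow{p_1p_2},\overrightarrow{q_1q_2}$, remove the arrows with the interiors of their arcs and add a curve joining $q_2$ to $p_1$ and one joining $p_2$ to $q_1$; the resulting closed curves form $B(A)$. For an edge $e$ with arrows $\overrightarrow{p_1p_2},\overrightarrow{q_1q_2}$: $A\setminus e$ removes the two arrows (not their arcs) and $e$; $A/e$ removes the arrows with the interiors of their arcs, identifies $p_1$ with $q_2$ and $p_2$ with $q_1$, and removes $e$; $A\dagger e$ (Penrose-contraction) does the same but identifies $p_1$ with $q_1$ and $p_2$ with $q_2$. A packaged arrow presentation is $P=(A,\mathcal V,\mathcal B)$ with $\mathcal V$ a partition of $V(A)$, $\mathcal B$ a partition of $B(A)$; $[v]$ is the block containing $v$. For an edge $e$ with incident vertices $u,v$ and incident boundary components $a,b$ (possibly equal): vertices of $A$ and $A\setminus e$ are identified; vertices of $A$ other than $u,v$ are identified with vertices of $A/e$ (resp. $A\dagger e$) and the rest form the set $T$ of created vertices; boundary components of $A$ and $A/e$ are identified; boundary components of $A$ other than $a,b$ are identified with those of $A\setminus e$ (resp. $A\dagger e$) and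 the rest form the set $S$ of created boundary components. Put $\mathcal V'=(\mathcal V-\{[u],[v]\})\cup\{[u]\cup[v]\}$, $\mathcal B'=(\mathcal B-\{[a],[b]\})\cup\{[a]\cup[b]\cup S-\{a,b\}\}$ ($S$ from deletion), $\mathcal V''=(\mathcal V-\{[u],[v]\})\cup\{[u]\cup[v]\cup T-\{u,v\}\}$ ($T$ from contraction), $\mathcal B''=(\mathcal B-\{[a],[b]\})\cup\{[a]\cup[b]\}$, and $\mathcal V''',\mathcal B'''$ defined like $\mathcal V'',\mathcal B'$ with $T,S$ created by the Penrose-contraction. Then $P\setminus e=(A\setminus e,\mathcal V,\mathcal B')$, $P\setminus_m e=(A\setminus e,\mathcal V',\mathcal B')$ (merge-deletion), $P/e=(A/e,\mathcal V'',\mathcal B)$, $P/_m e=(A/e,\mathcal V'',\mathcal B'')$ (merge-contraction), $P\dagger e=(A\dagger e,\mathcal V''',\mathcal B''')$. A coupling of edge $f$ of $P$ and edge $e$ of $H$ is a bijection from the two arrows of $f$ to the two arrows of $e$. 2-sum: with $P=(A,\mathcal V,\mathcal B)$, $H=(A',\mathcal V',\mathcal B')$ and $\varphi$ sending $\overrightarrow{p_1p_2}\mapsto\overrightarrow{q_1q_2}$, $\overrightarrow{p_3p_4}\mapsto\overrightarrow{q_3q_4}$, $A\oplus_\varphi A'$ deletes these four arrows with the interiors of their arcs and identifies $p_i$ with $q_i$ ($i=1,\dots,4$). Let $u$ (resp. $v$) be the vertex of $A$ containing $\overrightarrow{p_1p_2}$ (resp. $\overrightarrow{p_3p_4}$),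 $a$ (resp. $b$) the boundary component of $A$ containing $p_1,p_4$ (resp. $p_2,p_3$), and $u',v',a',b'$ likewise in $A'$. In $A\oplus_\varphi A'$ let $\alpha_0,\beta_0,\gamma_0,\delta_0$ be the vertices and $h,i,j,k$ the boundary components containing $p_1,p_2,p_3,p_4$ respectively. Then $P\oplus_\varphi H=(A\oplus_\varphi A',\mathcal V^*,\mathcal B^* )$ with $\mathcal V^*=(\mathcal V\cup\mathcal V'-\{[u],[v],[u'],[v']\})\cup\{[u]\cup[u']\cup\{\alpha_0,\beta_0\}-\{u,u'\}\}\cup\{[v]\cup[v']\cup\{\gamma_0,\delta_0\}-\{v,v'\}\}$ and $\mathcal B^*=(\mathcal B\cup\mathcal B'-\{[a],[b],[a'],[b']\})\cup\{[a]\cup[a']\cup\{h,k\}-\{a,a'\}\}\cup\{[b]\cup[b']\cup\{i,j\}-\{b,b'\}\}$. The tensor product $P\otimes_{\boldsymbol\varphi}H$ is obtained from $P$ by taking, for each edge $f$ of $P$, the 2-sum with a distinct copy $H^{(f)}$ of $H$ along the coupling of $f$ with the copy of $e$ induced by $\varphi_f$ (independent of order). Polynomial $Q$: $Q(P;a,b,c,x,y,\alpha,\beta,\gamma)$ is the unique map with $Q(P)=aQ(P\setminus e)+bQ(P/e)+cQ(P\dagger e)+xQ(P\setminus_m e)+yQ(P/_m e)$ for any edge $e$, and $Q(P)=\alpha^{|V(A)|}\beta^{|\mathcal V|}\gamma^{|\mathcal B|}$ when $A$ has no edges.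
   Formalization: In the 2-sum, when [u]=[v] or [u']=[v'] (likewise for a,b), the two stated new blocks need not form a partition (they may overlap or contain removed vertices); they are taken as one merged block. Otherwise the stated formula is used. *)

(* Defs.v *)
From mathcomp Require Import all_boot all_fingroup all_algebra ring.

Set Implicit Arguments.
Unset Strict Implicit.
Unset Printing Implicit Defensive.

Import GRing.Theory.
Local Open Scope ring_scope.

(* An arrow presentation is encoded by finitely many marked points on its     *)
(* circles, among them all the ends of arrows.  The points cut the circles    *)
(* into arcs, coloured alternately "arc" and "gap": [arc_end x] (resp.        *)
(* [gap_end x]) is the other end of the arc (resp. gap) at [x].  Every arrow  *)
(* lies along an arc; the labels in use are listed in [edges], and the two    *)
(* arrows labelled [l] go from [tip l i false] to [tip l i true], for         *)
(* [i = false, true].  Marked points that are not ends of arrows carry no     *)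
(* information: a circle without arrows is a circle with at least two idle    *)
(* points.  Values of [tip] at labels outside [edges] are irrelevant.         *)
Record arrow_pres := ArrowPres {
  point : finType;
  label : finType;
  edges : {set label};
  tip : label -> bool -> bool -> point;
  arc_end : {ffun point -> point};
  gap_end : {ffun point -> point} }.

Arguments tip : clear implicits.

Record arrow_pres_axioms (A : arrow_pres) : Prop := ArrowPresAxioms {
  arcK : involutive (arc_end A);
  gapK : involutive (gap_end A);
  arc_neq : forall x, arc_end A x != x;
  gap_neq : forall x, gap_end A x != x;
  tip_inj : forall l (i h : bool) m (j k : bool), l \in edges A -> m \in edges A ->
    tip A l i h = tip A m j k -> [/\ l = m, i = j & h = k];
  arc_tip : forall l (i h : bool), l \in edges A -> arc_end A (tip A l i h) = tip A l i (~~ h) }.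

Section Circles.
Variable T : finType.
Implicit Types (f g : T -> T) (x : T).

Definition circle_rel f g : rel T := fun x y => (y == f x) || (y == g x).

Definition circle f g x : {set T} := [set y | connect (circle_rel f g) x y].

Definition circles f g : {set {set T}} := [set circle f g x | x : T].

End Circles.

(* The curves of the boundary: on the ends of the arrows [p1 --> p2] and      *)
(* [q1 --> q2] of an edge, [p1] is joined to [q2] and [p2] to [q1].           *)
Definition side (A : arrow_pres) (x : point A) : point A :=
  if [pick t : label A * bool * bool |
        (t.1.1 \in edges A) && (tip A t.1.1 t.1.2 t.2 == x)] is Some t
  then tip A t.1.1 (~~ t.1.2) (~~ t.2) else arc_end A x.

Definition vertex (A : arrow_pres) := circle (arc_end A) (gap_end A).
Definition vertices (A : arrow_pres) := circles (arc_end A) (gap_end A).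
Definition boundary (A : arrow_pres) := circle (@side A) (gap_end A).
Definition boundaries (A : arrow_pres) := circles (@side A) (gap_end A).

(* Circles are sets of marked points.  Since the operations below keep the    *)
(* marked points, "identified" vertices or boundary components are equal.     *)

Definition delete (A : arrow_pres) (e : label A) : arrow_pres :=
  @ArrowPres (point A) (label A) (edges A :\ e) (tip A) (arc_end A) (gap_end A).

(* An arc whose ends get identified is kept as an arc. *)
Definition contract (A : arrow_pres) (e : label A) : arrow_pres :=
  let p1 := tip A e false false in let p2 := tip A e false true in
  let q1 := tip A e true false in let q2 := tip A e true true in
  @ArrowPres (point A) (label A) (edges A :\ e) (tip A)
    (finfun [eta arc_end A with p1 |-> q2, q2 |-> p1, p2 |-> q1, q1 |-> p2])
    (gap_end A).

Definition penrose (A : arrow_pres) (e : label A) : arrow_pres :=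
  let p1 := tip A e false false in let p2 := tip A e false true in
  let q1 := tip A e true false in let q2 := tip A e true true in
  @ArrowPres (point A) (label A) (edges A :\ e) (tip A)
    (finfun [eta arc_end A with p1 |-> q1, q1 |-> p1, p2 |-> q2, q2 |-> p2])
    (gap_end A).

Record packaged := Packaged {
  pres :> arrow_pres;
  vpart : {set {set {set point pres}}};
  bpart : {set {set {set point pres}}} }.

Record packaged_axioms (P : packaged) : Prop := PackagedAxioms {
  pres_axioms : arrow_pres_axioms P;
  vpartP : partition (vpart P) (vertices P);
  bpartP : partition (bpart P) (boundaries P) }.

Section Blocks.
Variable C : finType.
Implicit Types (W : {set {set C}}) (u v : C) (X Y S : {set C}).

Definition merge_blocks W u v :=
  (W :\: [set pblock W u; pblock W v]) :|: [set pblock W u :|: pblock W v].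

(* When [u] and [v] are replaced with the members of [S]. *)
Definition merge_blocks_new W u v S :=
  (W :\: [set pblock W u; pblock W v])
    :|: [set (pblock W u :|: pblock W v) :\: [set u; v] :|: S].

(* The members of [Y] left over when [u] and [v] leave [X]. *)
Definition created X Y u v := Y :\: (X :\: [set u; v]).

(* The block of [u] is joined with that of [u'], and the block of [v] with    *)
(* that of [v'].  If [u] and [v], or [u'] and [v'], already share a block,    *)
(* then the two unions are the same block of the result.                      *)
Definition glue W u v u' v' S1 S2 :=
  let bu := pblock W u in let bv := pblock W v in
  let bu' := pblock W u' in let bv' := pblock W v' in
  (W :\: [set bu; bv; bu'; bv']) :|:
  (if (bu == bv) || (bu' == bv') then
     [set (bu :|: bu' :|: bv :|: bv') :\: [set u; u'; v; v'] :|: (S1 :|: S2)]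
   else
     [set (bu :|: bu') :\: [set u; u'] :|: S1;
          (bv :|: bv') :\: [set v; v'] :|: S2]).

End Blocks.

Section Operations.
Variables (P : packaged) (e : label P).

Let u := vertex (tip P e false false).
Let v := vertex (tip P e true false).
Let a := boundary (tip P e false false).
Let b := boundary (tip P e false true).

Definition pdelete : packaged :=
  @Packaged (delete e) (vpart P)
    (merge_blocks_new (bpart P) a b
       (created (boundaries P) (boundaries (delete e)) a b)).

Definition pdelete_m : packaged :=
  @Packaged (delete e) (merge_blocks (vpart P) u v)
    (merge_blocks_new (bpart P) a b
       (created (boundaries P) (boundaries (delete e)) a b)).

Definition pcontract : packaged :=
  @Packaged (contract e)
    (merge_blocks_new (vpart P) u v
       (created (vertices P) (vertices (contract e)) u v))
    (bpart P).

Definition pcontract_m : packaged :=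
  @Packaged (contract e)
    (merge_blocks_new (vpart P) u v
       (created (vertices P) (vertices (contract e)) u v))
    (merge_blocks (bpart P) a b).

Definition ppenrose : packaged :=
  @Packaged (penrose e)
    (merge_blocks_new (vpart P) u v
       (created (vertices P) (vertices (penrose e)) u v))
    (merge_blocks_new (bpart P) a b
       (created (boundaries P) (boundaries (penrose e)) a b)).

End Operations.

Section TwoSum.
Variables (P H : packaged) (f : label P) (e : label H).
(* A coupling: arrow [i] of [f] goes to arrow [phi i] of [e]. *)
Variable phi : {perm bool}.

Let D : finType := (point P + point H)%type.
Let L : finType := (label P + label H)%type.
Let p i h : D := inl (tip P f i h).
Let q i h : D := inr (tip H e (phi i) h).

Definition sum_arc (x : D) : D :=
  match x with inl y => inl (arc_end P y) | inr y => inr (arc_end H y) end.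
Definition sum_gap (x : D) : D :=
  match x with inl y => inl (gap_end P y) | inr y => inr (gap_end H y) end.
Definition sum_tip (l : L) (i h : bool) : D :=
  match l with inl m => inl (tip P m i h) | inr m => inr (tip H m i h) end.

(* The identified points [p i h] and [q i h] are kept as the ends of an arc. *)
Definition two_sum_pres : arrow_pres :=
  @ArrowPres D L
    (inl @: (edges P :\ f) :|: inr @: (edges H :\ e))
    sum_tip
    (finfun [eta sum_arc with
       p false false |-> q false false, q false false |-> p false false,
       p false true |-> q false true, q false true |-> p false true,
       p true false |-> q true false, q true false |-> p true false,
       p true true |-> q true true, q true true |-> p true true])
    (finfun sum_gap).

Let S := two_sum_pres.

Definition sum_part (V : {set {set {set point P}}})
    (W : {set {set {set point H}}}) : {set {set {set D}}} :=
  [set [set inl @: (w : {set _}) | w in X : {set _}] | X in V]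
    :|: [set [set inr @: (w : {set _}) | w in X : {set _}] | X in W].

Let uP : {set D} := inl @: vertex (tip P f false false).
Let vP : {set D} := inl @: vertex (tip P f true false).
Let uH : {set D} := inr @: vertex (tip H e (phi false) false).
Let vH : {set D} := inr @: vertex (tip H e (phi true) false).
Let aP : {set D} := inl @: boundary (tip P f false false).
Let bP : {set D} := inl @: boundary (tip P f false true).
Let aH : {set D} := inr @: boundary (tip H e (phi false) false).
Let bH : {set D} := inr @: boundary (tip H e (phi false) true).

Definition two_sum : packaged :=
  @Packaged S
    (glue (sum_part (vpart P) (vpart H)) uP vP uH vH
       [set @vertex S (p false false); @vertex S (p false true)]
       [set @vertex S (p true false); @vertex S (p true true)])
    (glue (sum_part (bpart P) (bpart H)) aP bP aH bH
       [set @boundary S (p false false); @boundary S (p true true)]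
       [set @boundary S (p false true); @boundary S (p true false)]).

End TwoSum.

(* 2-sums of [P] with a new copy of [H] at the edges [iota f] of [P], for [f] *)
(* in [s] successively; [iota] follows the labels of the initial presentation *)
(* through the previous 2-sums.                                               *)
Fixpoint two_sums (L : finType) (H : packaged) (e : label H)
    (phi : L -> {perm bool}) (s : seq L) (P : packaged) (iota : L -> label P)
    : packaged :=
  if s is f :: s' then
    @two_sums L H e phi s' (two_sum (iota f) e (phi f)) (fun g => inl (iota g))
  else P.

(* [s] is an enumeration of the edges of [P]. *)
Definition tensor (P H : packaged) (e : label H) (phi : label P -> {perm bool})
    (s : seq (label P)) : packaged :=
  @two_sums (label P) H e phi s P id.

Section Polynomial.
Variables (K : comNzRingType) (a b c x y alpha beta gamma : K).

(* The edges are expanded in the order of [s].  By [Q_rec] below every edge   *)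
(* can be expanded first, and by [Q_unique] that determines [Q_poly].         *)
Fixpoint Q_along (P : packaged) (s : seq (label P)) : K :=
  if s is e :: s' then
    a * @Q_along (pdelete e) s' + b * @Q_along (pcontract e) s'
    + c * @Q_along (ppenrose e) s' + x * @Q_along (pdelete_m e) s'
    + y * @Q_along (pcontract_m e) s'
  else
    alpha ^+ #|vertices P| * beta ^+ #|vpart P| * gamma ^+ #|bpart P|.

Definition Q_poly (P : packaged) : K := @Q_along P (enum (edges P)).

End Polynomial.

Section System.
Variable K : comNzRingType.

Definition col5 (s : seq K) : 'cV[K]_5 := \col_(i < 5) s`_i.

Definition tensor_mx (alpha beta gamma : K) : 'M[K]_5 :=
  (alpha * beta * gamma) *: \matrix_(i < 5, j < 5)
    (nth [::]
       [:: [:: alpha * beta; 1; 1; alpha; 1];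
           [:: 1; alpha * gamma; 1; 1; alpha];
           [:: 1; 1; alpha; 1; 1];
           [:: alpha; 1; 1; alpha; 1];
           [:: 1; alpha; 1; 1; alpha]] i)`_j.

End System.

Section CircleTheory.
Variable T : finType.
Implicit Types (f g : T -> T) (x y : T).

Lemma eq_circles f f' g : f =1 f' -> circles f g = circles f' g.
Proof.
move=> ff'; rewrite /circles; apply: eq_imset => x; apply/setP=> y.
by rewrite !inE; apply: eq_connect => z t; rewrite /circle_rel ff'.
Qed.

Lemma circle_rel_sym f g :
  involutive f -> involutive g -> symmetric (circle_rel f g).
Proof.
move=> fK gK x y; rewrite /circle_rel.
by congr (_ || _); rewrite eq_sym; [rewrite -(can_eq fK) fK | rewrite -(can_eq gK) gK].
Qed.

Lemma mem_circle f g x : x \in circle f g x.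
Proof. by rewrite inE connect0. Qed.

Lemma mem_circles f g x : circle f g x \in circles f g.
Proof. exact: imset_f. Qed.

Lemma circles_partition f g :
  involutive f -> involutive g -> partition (circles f g) setT.
Proof.
move=> fK gK; have csym := sym_connect_sym (circle_rel_sym fK gK).
have -> : circles f g = equivalence_partition (connect (circle_rel f g)) setT.
  apply/setP=> B; apply/imsetP/imsetP => -[x _ ->]; exists x => //;
  by apply/setP=> y; rewrite !inE.
apply: equivalence_partitionP => x y z _ _ _; split; first exact: connect0.
by move=> xy; apply: (same_connect csym).
Qed.

Lemma circles_local f f' g p q :
    involutive f -> involutive g ->
    (forall x, x \notin circle f g p -> x \notin circle f g q -> f' x = f x) ->
  circles f g :\: [set circle f g p; circle f g q] \subset circles f' g.
Proof.
move=> fK gK ff'; have csym := sym_connect_sym (circle_rel_sym fK gK).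
apply/subsetP=> w; rewrite !inE negb_or => /andP[/andP[wp wq]].
case/imsetP=> x _ wx; move: wp wq; rewrite {w}wx => xp xq.
have stay r : circle f g x != circle f g r ->
    forall y, connect (circle_rel f g) x y -> y \notin circle f g r.
  move=> xr y xy; apply: contra xr; rewrite inE => ry; apply/eqP/setP=> z.
  by rewrite !inE (same_connect csym xy) (same_connect csym ry).
have loc y z : connect (circle_rel f g) x y ->
    circle_rel f' g y z = circle_rel f g y z.
  by move=> xy; rewrite /circle_rel ff' ?stay.
suff -> : circle f g x = circle f' g x by apply: mem_circles.
apply/setP=> y; rewrite !inE; apply/idP/idP => /connectP[s xs ->].
  elim/last_ind: s xs => [|s z IHs]; rewrite ?connect0 // rcons_path last_rcons.
  case/andP=> xs sz; apply: (connect_trans (IHs xs)); apply: connect1.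
  by rewrite loc //; apply/connectP; exists s.
elim/last_ind: s xs => [|s z IHs]; rewrite ?connect0 // rcons_path last_rcons.
case/andP=> xs sz; have := IHs xs => xl; apply: (connect_trans xl).
by apply: connect1; rewrite -loc.
Qed.

End CircleTheory.

Section BlockTheory.
Variable D : finType.
Implicit Types (X Y T : {set {set D}}) (W : {set {set {set D}}}).
Implicit Types (u v : {set D}) (p q x y z : D).

Lemma cover_created X Y u v :
    partition X setT -> partition Y setT -> u \in X -> v \in X ->
    X :\: [set u; v] \subset Y ->
  cover (created X Y u v) = u :|: v.
Proof.
move=> pX pY uX vX /subsetP sXY.
have tX := partition_trivIset pX; have tY := partition_trivIset pY.
have cX := cover_partition pX; have cY := cover_partition pY.
apply/setP=> x; apply/bigcupP/idP => [[w]|].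
  rewrite in_setD => /andP[wX wY] xw; apply: contraR wX => xuv.
  have xX : pblock X x \in X :\: [set u; v].
    rewrite !inE pblock_mem ?cX ?inE // andbT; apply: contra xuv.
    by case/orP=> /eqP <-; rewrite inE !mem_pblock cX inE ?orbT.
  by rewrite -(def_pblock tY wY xw)
     (def_pblock tY (sXY _ xX)) // mem_pblock cX inE.
move=> xuv; have xY : x \in cover Y by rewrite cY inE.
exists (pblock Y x); last by rewrite mem_pblock.
rewrite in_setD pblock_mem // andbT; apply/negP; rewrite !inE negb_or.
case/andP=> /andP[nu nv] zX.
have xz : x \in pblock Y x by rewrite mem_pblock.
case/setUP: xuv => xw.
  by rewrite -(def_pblock tX uX xw) (def_pblock tX zX xz) eqxx in nu.
by rewrite -(def_pblock tX vX xw) (def_pblock tX zX xz) eqxx in nv.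
Qed.

Lemma created_id X u v : u \in X -> v \in X -> created X X u v = [set u; v].
Proof.
move=> uX vX; apply/setP=> w; rewrite !inE negb_and negbK.
by case: (w \in X) / boolP => wX; rewrite ?orbF ?andbT // andbF; symmetry;
   apply/negP => /orP[]/eqP ww; rewrite ww ?uX ?vX in wX.
Qed.

Lemma merge_partition W X Y u v T :
    partition W X -> u \in X -> v \in X -> T != set0 ->
    T = created X Y u v -> X :\: [set u; v] \subset Y ->
  partition (merge_blocks_new W u v T) Y.
Proof.
move=> pW uX vX T0 TE sXY; have cW := cover_partition pW.
set bu := pblock W u; set bv := pblock W v.
have ubu : u \in bu by rewrite mem_pblock cW.
have vbv : v \in bv by rewrite mem_pblock cW.
have buW : bu \in W by rewrite pblock_mem ?cW.
have bvW : bv \in W by rewrite pblock_mem ?cW.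
have pR : partition (W :\: [set bu; bv]) (X :\: (bu :|: bv)).
  have [buv|nbuv] := eqVneq bu bv.
    by rewrite -buv setUid setUid; apply: partitionD1.
  rewrite -!setDDl; apply: partitionD1; first exact: partitionD1.
  by rewrite !inE eq_sym nbuv.
set N := (bu :|: bv) :\: [set u; v] :|: T.
have N0 : N != set0.
  by case/set0Pn: T0 => w wT; apply/set0Pn; exists w; rewrite inE wT orbT.
have sub b : b \in W -> forall w, w \in b -> w \in X.
  by move=> bW w; apply/subsetP: w; apply: partitionS pW _.
have dN : [disjoint N & X :\: (bu :|: bv)].
  rewrite -setI_eq0; apply/eqP/setP=> w; rewrite /N TE /created !inE.
  have [->|wu] := eqVneq w u; first by rewrite ubu ?orbT ?andbF /= ?andbF.
  have [->|wv] := eqVneq w v; first by rewrite vbv ?orbT /= ?andbF.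
  by case: (w \in bu); case: (w \in bv); case: (w \in X); rewrite ?andbF.
have := partitionU1 pR N0 dN; rewrite -/N setUC.
suff -> : N :|: X :\: (bu :|: bv) = Y by [].
apply/setP=> w; rewrite /N TE /created !inE.
have := subsetP sXY w; have := @sub _ buW w; have := @sub _ bvW w; rewrite !inE.
have [->|wu] := eqVneq w u; first by rewrite ubu /= => _ _ _; case: (u \in Y).
have [->|wv] := eqVneq w v; first by rewrite vbv !orbT /= => _ _ _; case: (v \in Y); rewrite ?orbT ?andbF ?andbT.
by case: (w \in bu); case: (w \in bv); case: (w \in X); case: (w \in Y) => //= h1 h2 h3;
  solve [exact: h1 | exact: h2 | exact: h3 | by have := h1 isT
        | by have := h2 isT | by have := h3 isT].
Qed.

Definition same_block W x y :=
  [exists B in W, (x \in cover B) && (y \in cover B)].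

Lemma same_blockP W x y :
  reflect (exists B, [/\ B \in W, x \in cover B & y \in cover B])
          (same_block W x y).
Proof.
apply: (iffP existsP) => [[B /and3P[]] | [B [BW xB yB]]]; exists B => //.
by apply/and3P.
Qed.

Section SameBlock.
Variables (X : {set {set D}}) (W : {set {set {set D}}}).
Hypotheses (pX : partition X setT) (pW : partition W X).

Lemma block_inj B B' x :
  B \in W -> B' \in W -> x \in cover B -> x \in cover B' -> B = B'.
Proof.
move=> BW BW' xB xB'; have [pc ci] := partition_partition pX pW.
apply: ci => //; have tc := partition_trivIset pc.
by rewrite -(def_pblock tc (imset_f _ BW) xB) (def_pblock tc (imset_f _ BW') xB').
Qed.

Lemma block_ex x : exists2 B, B \in W & x \in cover B.
Proof.
have [pc _] := partition_partition pX pW.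
have : x \in cover (cover @: W) by rewrite (cover_partition pc) inE.
by case/bigcupP=> _ /imsetP[B BW ->]; exists B.
Qed.

Lemma same_block_refl : reflexive (same_block W).
Proof. by move=> x; have [B BW xB] := block_ex x; apply/same_blockP; exists B. Qed.

Lemma same_block_sym : symmetric (same_block W).
Proof. by move=> x y; apply/same_blockP/same_blockP => -[B []]; exists B. Qed.

Lemma same_block_trans : transitive (same_block W).
Proof.
move=> y x z /same_blockP[B [BW xB yB]] /same_blockP[B' [BW' yB' zB]].
apply/same_blockP; exists B; split=> //.
by rewrite (block_inj BW BW' yB yB').
Qed.

Lemma same_block_merge u v T p q x y :
    u \in X -> v \in X -> p \in u -> q \in v -> cover T = u :|: v ->
  same_block (merge_blocks_new W u v T) x y =
  same_block W x y ||
    ((same_block W x p || same_block W x q) &&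
     (same_block W y p || same_block W y q)).
Proof.
move=> uX vX pu qv cT; have cW := cover_partition pW.
set bu := pblock W u; set bv := pblock W v.
have ubu : u \in bu by rewrite mem_pblock cW.
have vbv : v \in bv by rewrite mem_pblock cW.
have buW : bu \in W by rewrite pblock_mem ?cW.
have bvW : bv \in W by rewrite pblock_mem ?cW.
have pbu : p \in cover bu by apply/bigcupP; exists u.
have qbv : q \in cover bv by apply/bigcupP; exists v.
set N := (bu :|: bv) :\: [set u; v] :|: T.
have cN z : (z \in cover N) = (z \in cover bu) || (z \in cover bv).
  apply/idP/idP => [/bigcupP[w]|].
    rewrite !inE => /orP[/andP[_ /orP[wb|wb]] zw|wT zw].
    - by apply/orP; left; apply/bigcupP; exists w.
    - by apply/orP; right; apply/bigcupP; exists w.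
    have : z \in u :|: v by rewrite -cT; apply/bigcupP; exists w.
    by case/setUP=> zz; apply/orP; [left|right]; apply/bigcupP;
      [exists u | exists v].
  move=> zb; have [|zuv] := boolP (z \in u :|: v).
    by rewrite -cT => /bigcupP[w wT zw]; apply/bigcupP; exists w; rewrite // inE wT orbT.
  have [w wb zw] : exists2 w, w \in bu :|: bv & z \in w.
    by case/orP: zb => /bigcupP[w wb zw]; exists w; rewrite // inE wb ?orbT.
  apply/bigcupP; exists w => //; rewrite in_setU in_setD wb andbT !inE.
  apply/orP; left; apply: contra zuv.
  by case/orP=> /eqP <-; rewrite inE zw ?orbT.
have sp z : same_block W z p = (z \in cover bu).
  apply/same_blockP/idP => [[B [BW zB pB]]|zb]; last by exists bu.
  by rewrite (block_inj buW BW pbu pB).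
have sq z : same_block W z q = (z \in cover bv).
  apply/same_blockP/idP => [[B [BW zB qB]]|zb]; last by exists bv.
  by rewrite (block_inj bvW BW qbv qB).
rewrite !sp !sq -!cN; apply/same_blockP/orP => [[B []]|[/same_blockP[B [BW xB yB]]|/andP[xN yN]]].
- rewrite !inE => /orP[/andP[_ BW]|/eqP ->] xB yB; last by right; apply/andP.
  by left; apply/same_blockP; exists B.
- have [Bb|Bb] := boolP (B \in [set bu; bv]).
    exists N; split; first by rewrite !inE eqxx orbT.
      by rewrite cN; move: Bb; rewrite !inE => /orP[]/eqP<-; rewrite xB ?orbT.
    by rewrite cN; move: Bb; rewrite !inE => /orP[]/eqP<-; rewrite yB ?orbT.
  by exists B; split=> //; rewrite in_setU in_setD Bb BW.
- by exists N; split=> //; rewrite !inE eqxx orbT.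
Qed.

End SameBlock.

Lemma same_block_sub X W W' :
    partition X setT -> partition W X -> partition W' X ->
  same_block W =2 same_block W' -> W \subset W'.
Proof.
move=> pX pW pW' sW; apply/subsetP=> B BW; have tX := partition_trivIset pX.
have cW := cover_partition pW; have cW' := cover_partition pW'.
have nz w : w \in X -> exists x, x \in w.
  by move=> wX; apply/set0Pn; apply: partition_neq0 pX wX.
have sub Z b w : partition Z X -> b \in Z -> w \in b -> w \in X.
  by move=> pZ bZ; apply/subsetP: w; apply: partitionS pZ _.
have inc Z Z' b b' w0 x0 : partition Z X -> partition Z' X ->
    same_block Z =2 same_block Z' ->
    b \in Z -> b' \in Z' -> w0 \in b -> w0 \in b' -> x0 \in w0 -> b \subset b'.
  move=> pZ pZ' sZ bZ bZ' wb wb' xw; apply/subsetP=> w wB.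
  have wX := sub _ _ _ pZ bZ wB; have [x xw'] := nz _ wX.
  have : same_block Z x0 x.
    by apply/same_blockP; exists b; split=> //; apply/bigcupP;
       [exists w0 | exists w].
  rewrite sZ => /same_blockP[C [CZ x0C xC]].
  have x0b' : x0 \in cover b' by apply/bigcupP; exists w0.
  rewrite -(block_inj pX pZ' CZ bZ' x0C x0b'); case/bigcupP: xC => w' w'C xw''.
  rewrite -(def_pblock tX wX xw') (def_pblock tX _ xw'') //.
  exact: sub pZ' CZ w'C.
have [w0 w0B] : exists w, w \in B by apply/set0Pn; apply: partition_neq0 pW BW.
have w0X := sub _ _ _ pW BW w0B; have [x0 x0w] := nz _ w0X.
have bW' : pblock W' w0 \in W' by rewrite pblock_mem ?cW'.
have wb' : w0 \in pblock W' w0 by rewrite mem_pblock cW'.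
suff -> : B = pblock W' w0 by [].
apply/eqP; rewrite eqEsubset (inc _ _ _ _ _ _ pW pW' sW BW bW' w0B wb' x0w) /=.
by apply: (inc _ _ _ _ _ _ pW' pW _ bW' BW wb' w0B x0w) => x y; rewrite sW.
Qed.

Lemma same_block_eq X W W' :
    partition X setT -> partition W X -> partition W' X ->
  same_block W =2 same_block W' -> W = W'.
Proof.
move=> pX pW pW' sW; apply/eqP; rewrite eqEsubset.
by rewrite !(same_block_sub pX) // => x y; rewrite sW.
Qed.

End BlockTheory.

Section ArrowTheory.
Variable A : arrow_pres.
Hypothesis hA : arrow_pres_axioms A.
Implicit Types (l m : label A) (i h : bool) (x : point A).

Lemma tip_eq l i h m j k : l \in edges A -> m \in edges A ->
  (tip A l i h == tip A m j k) = [&& l == m, i == j & h == k].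
Proof.
move=> lE mE; apply/eqP/and3P => [/(tip_inj hA lE mE)[-> -> ->] //|].
by case=> /eqP-> /eqP-> /eqP->.
Qed.

Definition is_tip l x := [exists i, [exists h, x == tip A l i h]].

Lemma is_tipP l x : reflect (exists i h, x = tip A l i h) (is_tip l x).
Proof.
apply: (iffP existsP) => [[i /existsP[h /eqP xt]]|[i [h xt]]]; exists i.
  by exists h.
by apply/existsP; exists h; apply/eqP.
Qed.

Lemma is_tip_neq l m i h : l \in edges A -> m \in edges A -> l != m ->
  ~~ is_tip l (tip A m i h).
Proof.
move=> lE mE lm; apply/is_tipP => -[j [k /eqP]].
by rewrite tip_eq // eq_sym (negbTE lm).
Qed.

Lemma side_tip l i h : l \in edges A -> side (tip A l i h) = tip A l (~~ i) (~~ h).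
Proof.
move=> lE; rewrite /side; case: pickP => [[[m j] k] /= /andP[mE]|/(_ (l, i, h))].
  by move/eqP/(tip_inj hA mE lE) => [-> -> ->].
by rewrite /= lE eqxx.
Qed.

Lemma side_arc x : (forall l, l \in edges A -> ~~ is_tip l x) -> side x = arc_end A x.
Proof.
move=> nx; rewrite /side; case: pickP => [[[m j] k] /= /andP[mE /eqP xm]|//].
by case/is_tipP: (nx _ mE); exists j, k.
Qed.

End ArrowTheory.

(* [k] tells how the ends of the arrows of [e] are rejoined; it is            *)
(* (false, true) for deletion, (true, true) for contraction and               *)
(* (true, false) for Penrose-contraction.                                     *)
Definition surgery (k : bool * bool) (A : arrow_pres) (e : label A)
    (arc_end' : {ffun point A -> point A}) : Prop :=
  (forall i h, arc_end' (tip A e i h) = tip A e (k.1 (+) i) (k.2 (+) h))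
  /\ (forall x, ~~ is_tip e x -> arc_end' x = arc_end A x).

Definition with_arc (A : arrow_pres) (e : label A)
    (arc_end' : {ffun point A -> point A}) : arrow_pres :=
  @ArrowPres (point A) (label A) (edges A :\ e) (tip A) arc_end' (gap_end A).

Section Surgery.
Variables (A : arrow_pres) (e : label A).
Hypotheses (hA : arrow_pres_axioms A) (eE : e \in edges A).

Lemma surgery_delete : surgery (false, true) e (arc_end A).
Proof. by split=> // i h; rewrite (arc_tip hA) ?addFb ?addTb. Qed.

Lemma surgery_contract : surgery (true, true) e (arc_end (contract e)).
Proof.
split=> [i h|x nx].
  by rewrite ffunE /= !(tip_eq hA) // eqxx; case: i; case: h.
have nt i h : x == tip A e i h = false.
  by apply/negP => /eqP xt; case/is_tipP: nx; exists i, h.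
by rewrite ffunE /= !nt.
Qed.

Lemma surgery_penrose : surgery (true, false) e (arc_end (penrose e)).
Proof.
split=> [i h|x nx].
  by rewrite ffunE /= !(tip_eq hA) // eqxx; case: i; case: h.
have nt i h : x == tip A e i h = false.
  by apply/negP => /eqP xt; case/is_tipP: nx; exists i, h.
by rewrite ffunE /= !nt.
Qed.

Variables (k : bool * bool) (arc_end' : {ffun point A -> point A}).
Hypotheses (k0 : k.1 || k.2) (hS : surgery k e arc_end').
Let A' := with_arc e arc_end'.

Lemma arc_nontip x : ~~ is_tip e x -> ~~ is_tip e (arc_end A x).
Proof.
apply: contra => /is_tipP[i [h xt]]; apply/is_tipP; exists i, (~~ h).
by rewrite -(arc_tip hA) // -xt (arcK hA).
Qed.

Lemma surgery_axioms : arrow_pres_axioms A'.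
Proof.
have [ht hn] := hS; split=> /=.
- move=> x; have [/is_tipP[i [h ->]]|nx] := boolP (is_tip e x).
    by rewrite !ht !addbA !addbb.
  by rewrite !hn ?(arcK hA) // arc_nontip.
- exact: (gapK hA).
- move=> x; have [/is_tipP[i [h ->]]|nx] := boolP (is_tip e x).
    rewrite ht (tip_eq hA) // eqxx /=; move: k0.
    by case: k.1; case: k.2; case: i; case: h.
  by rewrite hn // (arc_neq hA).
- exact: (gap_neq hA).
- by move=> l i h m j k'; rewrite !inE => /andP[_ lE] /andP[_ mE]; apply: (tip_inj hA).
- move=> l i h; rewrite !inE => /andP[le lE].
  by rewrite hn ?(arc_tip hA) // is_tip_neq // eq_sym.
Qed.

Lemma surgery_side (x : point A) :
  @side A' x = if is_tip e x then arc_end' x else @side A x.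
Proof.
case: ifP => [/is_tipP[i [h ->]]|/negbT nx].
  apply: (side_arc (A := A')) => l; rewrite !inE => /andP[le lE].
  by apply: (is_tip_neq hA) => //; rewrite eq_sym.
rewrite /side /= (hS.2 _ nx); congr (if _ is Some _ then _ else _).
  apply: eq_pick => -[[l i] h] /=; rewrite !inE.
  by case: eqVneq => //= ->; symmetry; apply/andP => -[_ /eqP xt];
     case/is_tipP: nx; exists i, h.
Qed.

End Surgery.

Lemma sideK A : arrow_pres_axioms A -> involutive (@side A).
Proof.
move=> hA x; have [/existsP[l /andP[lE]]|nx] := boolP [exists l in edges A, is_tip l x].
  by case/is_tipP=> i [h ->]; rewrite !(side_tip hA) // !negbK.
have ns l : l \in edges A -> ~~ is_tip l x.
  by move=> lE; apply: contra nx => lx; apply/existsP; exists l; rewrite lE.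
rewrite (side_arc ns) side_arc ?(arcK hA) // => l lE.
by apply: arc_nontip => //; apply: ns.
Qed.

Lemma vertices_partition A : arrow_pres_axioms A -> partition (vertices A) setT.
Proof. by move=> hA; apply: circles_partition; [apply: arcK | apply: gapK]. Qed.

Lemma boundaries_partition A :
  arrow_pres_axioms A -> partition (boundaries A) setT.
Proof. by move=> hA; apply: circles_partition; [apply: sideK | apply: gapK]. Qed.

Lemma circle_step (T : finType) (f g : T -> T) x y :
  y = f x -> y \in circle f g x.
Proof. by move->; rewrite inE; apply: connect1; rewrite /circle_rel eqxx. Qed.

Section SurgeryCircles.
Variables (A : arrow_pres) (e : label A).
Hypotheses (hA : arrow_pres_axioms A) (eE : e \in edges A).
Variables (k : bool * bool) (arc_end' : {ffun point A -> point A}).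
Hypotheses (k0 : k.1 || k.2) (hS : surgery k e arc_end').
Let A' := with_arc e arc_end'.
Let p := tip A e false false.
Let q := tip A e true false.
Let r := tip A e false true.

Lemma tip_vertex x : is_tip e x -> (x \in vertex p) || (x \in vertex q).
Proof.
case/is_tipP=> i [h ->]; apply/orP; case: i; case: h.
- by right; apply: circle_step; rewrite (arc_tip hA).
- by right; apply: mem_circle.
- by left; apply: circle_step; rewrite (arc_tip hA).
- by left; apply: mem_circle.
Qed.

Lemma tip_boundary x : is_tip e x -> (x \in boundary p) || (x \in boundary r).
Proof.
case/is_tipP=> i [h ->]; apply/orP; case: i; case: h.
- by left; apply: circle_step; rewrite (side_tip hA).
- by right; apply: circle_step; rewrite (side_tip hA).
- by right; apply: mem_circle.
- by left; apply: mem_circle.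
Qed.

Lemma surgery_vertices :
  vertices A :\: [set vertex p; vertex q] \subset vertices A'.
Proof.
apply: circles_local; [exact: arcK | exact: gapK | move=> x xp xq].
by apply: hS.2; apply/negP => /tip_vertex; rewrite (negbTE xp) (negbTE xq).
Qed.

Lemma surgery_boundaries :
  boundaries A :\: [set boundary p; boundary r] \subset boundaries A'.
Proof.
apply: circles_local; [exact: sideK | exact: gapK | move=> x xp xq].
rewrite (surgery_side hA eE hS); case: ifP => // /tip_boundary.
by rewrite (negbTE xp) (negbTE xq).
Qed.

End SurgeryCircles.

Lemma delete_vertices A (e : label A) : vertices (delete e) = vertices A.
Proof. by []. Qed.

Lemma contract_boundaries A (e : label A) :
  arrow_pres_axioms A -> e \in edges A -> boundaries (contract e) = boundaries A.
Proof.
move=> hA eE; apply: eq_circles => x.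
rewrite (surgery_side hA eE (surgery_contract hA eE)).
case: ifP => // /is_tipP[i [h ->]].
by rewrite (surgery_contract hA eE).1 (side_tip hA).
Qed.

Lemma surgery_comm A (e f : label A) ke kf ae af aef afe :
    arrow_pres_axioms A -> e \in edges A -> f \in edges A -> e != f ->
    surgery ke e ae -> surgery kf f af ->
    @surgery kf (with_arc e ae) f aef -> @surgery ke (with_arc f af) e afe ->
  aef = afe.
Proof.
move=> hA eE fE ef [e1 e2] [f1 f2] [ef1 ef2] [fe1 fe2].
apply/ffunP=> x; have [/is_tipP[i [h ->]]|xe] := boolP (is_tip e x).
  have nt : ~~ is_tip f (tip A e i h) by apply: is_tip_neq; rewrite // eq_sym.
  by rewrite ef2 //= e1 fe1.
have [/is_tipP[i [h xf]]|xf] := boolP (is_tip f x).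
  by rewrite fe2 //= xf f1 ef1.
by rewrite ef2 //= e2 // fe2 //= f2.
Qed.

Section Joining.
Variable T : eqType.
Implicit Types (r t : rel T) (w : bool) (p q x y : T).

Definition equiv_rel r := [/\ reflexive r, symmetric r & transitive r].

Definition join_rel w r p q : rel T :=
  fun x y => r x y || [&& w, r x p || r x q & r y p || r y q].

Lemma join_rel_equiv w r p q : equiv_rel r -> equiv_rel (join_rel w r p q).
Proof.
case=> rr rs rt; split=> [x|x y|y x z]; rewrite /join_rel.
- by rewrite rr.
- by rewrite rs; congr (_ || (_ && _)); rewrite andbC.
have tr u a b : r a b -> r b u -> r a u by move=> ab; apply: rt.
case/orP=> [xy|/and3P[-> px py]] /orP[yz|].
- by rewrite (rt _ _ _ xy yz).
- case/and3P=> -> py pz; rewrite /= pz andbT; apply/orP; right.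
  by case/orP: py => [/(tr _ _ _ xy)->|/(tr _ _ _ xy)->]; rewrite ?orbT.
- rewrite /= px /=; apply/orP; right; rewrite rs in yz.
  by case/orP: py => [/(tr _ _ _ yz)->|/(tr _ _ _ yz)->]; rewrite ?orbT.
- by case/and3P=> _ _ pz; rewrite /= px pz orbT.
Qed.

Lemma join_rel_sub w r p q x y : r x y -> join_rel w r p q x y.
Proof. by rewrite /join_rel => ->. Qed.

Lemma join_rel_pq w r p q : equiv_rel r -> w -> join_rel w r p q p q.
Proof. by case=> rr _ _ w1; rewrite /join_rel w1 !rr !orbT. Qed.

Lemma join_rel_min w r p q t : equiv_rel t -> subrel r t ->
  (w -> t p q) -> subrel (join_rel w r p q) t.
Proof.
case=> tr ts tt rt wt x y; rewrite /join_rel => /orP[/rt //|/and3P[/wt tpq xp yp]].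
have xp' : t x p.
  by case/orP: xp => /rt // xq; apply: tt xq _; rewrite ts.
have yp' : t y p.
  by case/orP: yp => /rt // yq; apply: tt yq _; rewrite ts.
by apply: tt xp' _; rewrite ts.
Qed.

Lemma join_relC w w' r p q p' q' : equiv_rel r ->
  join_rel w' (join_rel w r p q) p' q' =2 join_rel w (join_rel w' r p' q') p q.
Proof.
move=> er; have sub a a' b b' c c' : subrel (join_rel a' (join_rel a r b c) b' c')
    (join_rel a (join_rel a' r b' c') b c).
  have e1 := join_rel_equiv a' b' c' er; have e2 := join_rel_equiv a b c e1.
  apply: join_rel_min => //.
    apply: join_rel_min => // [x y xy|a1]; last exact: join_rel_pq.
    by do 2 apply: join_rel_sub.
  by move=> a1; apply: join_rel_sub; apply: join_rel_pq.
by move=> x y; apply/idP/idP; apply: sub.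
Qed.

Lemma eq_join_rel w r r' p q : r =2 r' -> join_rel w r p q =2 join_rel w r' p q.
Proof. by move=> rr' x y; rewrite /join_rel !rr'. Qed.

End Joining.

Lemma packaged_ext (A : arrow_pres) (E1 E2 : {set label A})
    (c1 c2 : {ffun point A -> point A}) (v1 v2 b1 b2 : {set {set {set point A}}}) :
    let P1 := @Packaged (ArrowPres E1 (tip A) c1 (gap_end A)) v1 b1 in
    let P2 := @Packaged (ArrowPres E2 (tip A) c2 (gap_end A)) v2 b2 in
    packaged_axioms P1 -> packaged_axioms P2 -> E1 = E2 -> c1 = c2 ->
    same_block v1 =2 same_block v2 -> same_block b1 =2 same_block b2 ->
  P1 = P2.
Proof.
move=> P1 P2 h1 h2 EE cc; rewrite /P2 -EE -cc in h2 *; rewrite {}/P1 in h1 *.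
case: h1 h2 => /= [hA pv1 pb1] [/= _ pv2 pb2] sv sb; congr Packaged.
  exact: same_block_eq (vertices_partition hA) pv1 pv2 sv.
exact: same_block_eq (boundaries_partition hA) pb1 pb2 sb.
Qed.

Inductive operation := Del | Con | Pen | DelM | ConM.

Section Uniform.
Variables (o : operation) (P : packaged) (e : label P).

Definition op_kind : bool * bool :=
  match o with
  | Del | DelM => (false, true) | Con | ConM => (true, true) | Pen => (true, false)
  end.

Definition op_arc : {ffun point P -> point P} :=
  match o with
  | Del | DelM => arc_end P
  | Con | ConM => arc_end (contract e)
  | Pen => arc_end (penrose e)
  end.

Definition op_vpart : {set {set {set point P}}} :=
  match o with
  | Del => vpart (pdelete e) | DelM => vpart (pdelete_m e)
  | Con => vpart (pcontract e) | ConM => vpart (pcontract_m e)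
  | Pen => vpart (ppenrose e)
  end.

Definition op_bpart : {set {set {set point P}}} :=
  match o with
  | Del => bpart (pdelete e) | DelM => bpart (pdelete_m e)
  | Con => bpart (pcontract e) | ConM => bpart (pcontract_m e)
  | Pen => bpart (ppenrose e)
  end.

Definition op_pack : packaged := @Packaged (with_arc e op_arc) op_vpart op_bpart.

Definition joins_v := if o is Del then false else true.
Definition joins_b := if o is Con then false else true.

Hypotheses (hP : packaged_axioms P) (eE : e \in edges P).
Let hA := pres_axioms hP.

Lemma op_surgery : surgery op_kind e op_arc.
Proof.
rewrite /op_kind /op_arc; case: o.
- exact: (surgery_delete hA eE).
- exact: (surgery_contract hA eE).
- exact: (surgery_penrose hA eE).
- exact: (surgery_delete hA eE).
- exact: (surgery_contract hA eE).
Qed.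

Lemma op_kind_neq0 : op_kind.1 || op_kind.2. Proof. by rewrite /op_kind; case: o. Qed.

Let p := tip P e false false.
Let q := tip P e true false.
Let r := tip P e false true.

Lemma merge_blocksE (D : finType) (X : {set {set D}}) (W : {set {set {set D}}}) u v :
  partition W X -> u \in X -> v \in X ->
  merge_blocks W u v = merge_blocks_new W u v [set u; v].
Proof.
move=> pW uX vX; have cW := cover_partition pW; congr (_ :|: [set _]).
apply/setP=> w; rewrite !inE.
have [->|wu] := eqVneq w u; first by rewrite mem_pblock cW uX /= ?orbT.
have [->|wv] := eqVneq w v; first by rewrite mem_pblock cW vX /= ?orbT.
by rewrite !orbF.
Qed.

Lemma merged (D : finType) (X Y : {set {set D}}) (W : {set {set {set D}}})
    u v (x y : D) :
    partition X setT -> partition Y setT -> partition W X -> u \in X -> v \in X ->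
    x \in u -> y \in v -> X :\: [set u; v] \subset Y ->
  let W' := merge_blocks_new W u v (created X Y u v) in
  partition W' Y /\ same_block W' =2 join_rel true (same_block W) x y.
Proof.
move=> pX pY pW uX vX xu yv sXY; have cT := cover_created pX pY uX vX sXY.
split.
  apply: merge_partition pW uX vX _ _ sXY => //; apply/set0Pn.
  have : x \in cover (created X Y u v) by rewrite cT inE xu.
  by case/bigcupP=> w wT _; exists w.
by move=> z t; exact: (same_block_merge pX pW z t uX vX xu yv cT).
Qed.

Lemma merged_id (D : finType) (X : {set {set D}}) (W : {set {set {set D}}})
    u v (x y : D) :
    partition X setT -> partition W X -> u \in X -> v \in X -> x \in u -> y \in v ->
  partition (merge_blocks W u v) X /\
  same_block (merge_blocks W u v) =2 join_rel true (same_block W) x y.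
Proof.
move=> pX pW uX vX xu yv; rewrite (merge_blocksE pW) // -(created_id uX vX).
by apply: merged => //; apply: subsetDl.
Qed.

Lemma op_spec :
  [/\ packaged_axioms op_pack,
      same_block op_vpart =2 join_rel joins_v (same_block (vpart P)) p q
    & same_block op_bpart =2 join_rel joins_b (same_block (bpart P)) p r].
Proof.
have hA' := surgery_axioms hA eE op_kind_neq0 op_surgery.
have pV := vertices_partition hA; have pB := boundaries_partition hA.
have pV' := vertices_partition hA'; have pB' := boundaries_partition hA'.
have sV := surgery_vertices hA eE op_surgery.
have sB := surgery_boundaries hA eE op_surgery.
have [_ wV wB] := hP.
have V1 := merged pV pV' wV (mem_circles _ _ p) (mem_circles _ _ q)
  (mem_circle _ _ p) (mem_circle _ _ q) sV.
have B1 := merged pB pB' wB (mem_circles _ _ p) (mem_circles _ _ r)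
  (mem_circle _ _ p) (mem_circle _ _ r) sB.
have V2 := merged_id pV wV (mem_circles _ _ p) (mem_circles _ _ q)
  (mem_circle _ _ p) (mem_circle _ _ q).
have B2 := merged_id pB wB (mem_circles _ _ p) (mem_circles _ _ r)
  (mem_circle _ _ p) (mem_circle _ _ r).
have jf (T : eqType) (t : rel T) a b : t =2 join_rel false t a b.
  by move=> x y; rewrite /join_rel orbF.
have cB := contract_boundaries hA eE.
suff [v1 v2 b1 b2] :
  [/\ partition op_vpart (vertices (with_arc e op_arc)),
     same_block op_vpart =2 join_rel joins_v (same_block (vpart P)) p q,
     partition op_bpart (boundaries (with_arc e op_arc))
   & same_block op_bpart =2 join_rel joins_b (same_block (bpart P)) p r].
  by split=> //; split.
rewrite /joins_v /joins_b /op_vpart /op_bpart.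
move: V1 B1; rewrite /op_arc; case: o => -[V1 V1'] [B1 B1'] /=.
- by split=> //; apply: jf.
- by split; [exact: V1 | exact: V1' | rewrite [boundaries _]cB; exact: wB | exact: jf].
- by split; [exact: V1 | exact: V1' | exact: B1 | exact: B1'].
- by case: V2 => V2 V2'; split; [exact: V2 | exact: V2' | exact: B1 | exact: B1'].
- case: B2 => B2 B2'; split; [exact: V1 | exact: V1' | rewrite [boundaries _]cB; exact: B2 | exact: B2'].
Qed.

End Uniform.

Lemma op_packC o o' (P : packaged) (e f : label P) :
    packaged_axioms P -> e \in edges P -> f \in edges P -> e != f ->
  @op_pack o' (op_pack o e) f = @op_pack o (op_pack o' f) e.
Proof.
move=> hP eE fE ef.
have [hPe ve be] := op_spec o hP eE; have [hPf vf bf] := op_spec o' hP fE.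
have fE' : f \in edges (op_pack o e) by rewrite !inE eq_sym ef.
have eE' : e \in edges (op_pack o' f) by rewrite !inE ef.
have [hPef vef bef] := op_spec o' hPe fE'.
have [hPfe vfe bfe] := op_spec o hPf eE'.
have [_ wV wB] := hP; have hA := pres_axioms hP.
have eqv W X (pX : partition X setT) (pW : partition W X) :
    equiv_rel (@same_block (point P) W).
  split; [exact: same_block_refl pX pW | exact: same_block_sym
         | exact: same_block_trans pX pW].
apply: (packaged_ext (A := P)) hPef hPfe _ _ _ _.
- by rewrite /= !setDDl setUC.
- apply: (surgery_comm hA eE fE ef (op_surgery o hP eE) (op_surgery o' hP fE)).
    exact: (op_surgery o' hPe fE').
  exact: (op_surgery o hPf eE').
- move=> x y; rewrite vef vfe (eq_join_rel _ _ _ ve) (eq_join_rel _ _ _ vf).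
  exact/join_relC/eqv/wV/vertices_partition.
- move=> x y; rewrite bef bfe (eq_join_rel _ _ _ be) (eq_join_rel _ _ _ bf).
  exact/join_relC/eqv/wB/boundaries_partition.
Qed.

Section QTheory.
Variables (K : comNzRingType) (a b c x y alpha beta gamma : K).
Local Notation Q := (Q_poly a b c x y alpha beta gamma).

Definition Q_expansion (R : packaged -> K) (P : packaged) (e : label P) : K :=
  a * R (op_pack Del e) + b * R (op_pack Con e) + c * R (op_pack Pen e)
  + x * R (op_pack DelM e) + y * R (op_pack ConM e).

Lemma Q_expansionE R (P : packaged) (e : label P) (G : operation -> K) :
    (forall o, R (op_pack o e) = G o) ->
  Q_expansion R e = a * G Del + b * G Con + c * G Pen + x * G DelM + y * G ConM.
Proof. by move=> RG; rewrite /Q_expansion !RG. Qed.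

Lemma Q_head (P : packaged) (e : label P) (s : seq (label P)) :
  enum (edges P) = e :: s -> Q P = Q_expansion Q e.
Proof.
move=> Es; have us : uniq (e :: s) by rewrite -Es enum_uniq.
have Ee : enum (edges P :\ e) = s.
  have : enum (edges P :\ e) = [seq l <- enum (edges P) | l != e].
    by rewrite /enum_mem -filter_predI; apply: eq_filter => l; rewrite /= in_setD1.
  case/andP: us => es _.
  rewrite Es /= eqxx /= => ->; apply/all_filterP/allP => l ls.
  by apply: contraNneq es => <-.
have QE o : Q (op_pack o e) = @Q_along K a b c x y alpha beta gamma (op_pack o e) s.
  by rewrite /Q /= Ee.
by rewrite /Q_expansion !QE /Q_poly Es.
Qed.

Lemma Q_rec (P : packaged) (e : label P) :
    packaged_axioms P -> e \in edges P ->
  Q P = a * Q (pdelete e) + b * Q (pcontract e) + c * Q (ppenrose e)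
        + x * Q (pdelete_m e) + y * Q (pcontract_m e).
Proof.
change (packaged_axioms P -> e \in edges P -> Q P = Q_expansion Q e).
have [n] := ubnP #|edges P|; elim: n => // n IHn in P e *.
rewrite ltnS => leEn hP eE.
case Es : (enum (edges P)) => [|f s]; first by rewrite -mem_enum Es in eE.
rewrite (Q_head Es); have fE : f \in edges P by rewrite -mem_enum Es mem_head.
have [->//|ef] := eqVneq e f.
have lt o g : g \in edges P -> (#|edges (op_pack o g)| < n)%N.
  by move=> gE; apply: leq_trans leEn; rewrite (cardsD1 g (edges P)) gE.
have Qe o : Q (op_pack o f) = @Q_expansion Q (op_pack o f) e.
  apply: IHn; [exact: lt | by case: (op_spec o hP fE) | by rewrite !inE ef].
have Qf o : Q (op_pack o e) = @Q_expansion Q (op_pack o e) f.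
  apply: IHn; [exact: lt | by case: (op_spec o hP eE) | by rewrite !inE eq_sym ef].
have [F Fe Ff] : exists2 F : operation -> operation -> K,
    forall o, Q (op_pack o e) =
      a * F o Del + b * F o Con + c * F o Pen + x * F o DelM + y * F o ConM
  & forall o, Q (op_pack o f) =
      a * F Del o + b * F Con o + c * F Pen o + x * F DelM o + y * F ConM o.
  exists (fun o o' => Q (@op_pack o' (op_pack o e) f)) => o; first exact: Qf.
  apply: etrans (Qe o) _.
  apply: (@Q_expansionE Q (op_pack o f) e (fun o' => Q (@op_pack o (op_pack o' e) f))).
  by move=> o'; congr Q_poly; symmetry; apply: op_packC.
rewrite (Q_expansionE Fe) (Q_expansionE Ff).
by move: F {Fe Ff} => F; ring.
Qed.

Lemma Q_edgeless (P : packaged) : edges P = set0 ->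
  Q P = alpha ^+ #|vertices P| * beta ^+ #|vpart P| * gamma ^+ #|bpart P|.
Proof. by move=> E0; rewrite /Q_poly E0 enum_set0. Qed.

Lemma Q_unique (R : packaged -> K) :
    (forall (P : packaged) (e : label P), packaged_axioms P -> e \in edges P ->
       R P = a * R (pdelete e) + b * R (pcontract e) + c * R (ppenrose e)
             + x * R (pdelete_m e) + y * R (pcontract_m e)) ->
    (forall P : packaged, packaged_axioms P -> edges P = set0 ->
       R P = alpha ^+ #|vertices P| * beta ^+ #|vpart P| * gamma ^+ #|bpart P|) ->
  forall P : packaged, packaged_axioms P -> R P = Q P.
Proof.
move=> Rrec R0 P; have [n] := ubnP #|edges P|; elim: n => // n IHn in P *.
rewrite ltnS => leEn hP; have [E0|[e eE]] := set_0Vmem (edges P).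
  by rewrite R0 // Q_edgeless.
have IH o : R (op_pack o e) = Q (op_pack o e).
  apply: IHn; last by case: (op_spec o hP eE).
  by apply: leq_trans leEn; rewrite (cardsD1 e (edges P)) eE.
apply: etrans (Rrec P e hP eE) _; apply: etrans (esym (Q_rec hP eE)).
exact: (@Q_expansionE R P e (fun o => Q (op_pack o e)) IH).
Qed.

End QTheory.

Section SystemTheory.
Variable K : fieldType.

Lemma det_laplace0 n (f : nat -> nat -> K) :
  \det (\matrix_(i < n.+1, j < n.+1) f i j) =
  \sum_(j < n.+1) f 0%N j * ((-1) ^+ j *
     \det (\matrix_(i < n, k < n) f i.+1 (bump j k))).
Proof.
rewrite (expand_det_row _ ord0); apply: eq_bigr => j _; rewrite mxE /cofactor add0n.
congr (_ * (_ * \det _)); apply/matrixP=> i k; rewrite !mxE.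
by congr f.
Qed.

Fixpoint laplace n (f : nat -> nat -> K) : K :=
  if n is m.+1 then
    foldr (fun j d => f 0%N j * ((-1) ^+ j * laplace m (fun i k => f i.+1 (bump j k))) + d)
      0 (iota 0 n)
  else 1.

Lemma det_laplace n (f : nat -> nat -> K) :
  \det (\matrix_(i < n, j < n) f i j) = laplace n f.
Proof.
elim: n f => [|n IHn] f; first by rewrite det_mx00.
rewrite det_laplace0 -(big_mkord predT (fun j => f 0%N j * ((-1) ^+ j *
  \det (\matrix_(i < n, k < n) f i.+1 (bump j k))))).
rewrite /index_iota subn0 [RHS]/laplace -/laplace; elim: (iota 0 n.+1) => [|j s IHs].
  by rewrite big_nil.
by rewrite big_cons IHs (IHn (fun i k => f i.+1 (bump j k))).
Qed.

Lemma det_tensor_mx (alpha beta gamma : K) :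
  \det (tensor_mx alpha beta gamma) =
  (alpha * beta * gamma) ^+ 5 *
  (alpha ^+ 2 * (beta - 1) * (gamma - 1) * (alpha - 1) ^+ 2 * (alpha + 2)).
Proof.
rewrite /tensor_mx detZ; congr (_ * _).
rewrite (det_laplace 5 (fun i j => (nth [::] _ i)`_j)).
by cbn [laplace foldr iota nth bump leq subn subn_rec Nat.sub addn addn_rec Nat.add nat_of_bool]; rewrite /=; ring.
Qed.

Lemma tensor_mx_unit (alpha beta gamma : K) :
  (tensor_mx alpha beta gamma \in unitmx) =
  [&& alpha * beta * gamma != 0, alpha != 1, alpha + 2 != 0, beta != 1
    & gamma != 1].
Proof.
rewrite unitmxE unitfE det_tensor_mx !(mulf_eq0, expf_eq0) !subr_eq0 /= !negb_or.
by case: (alpha == 0); case: (beta == 0); case: (gamma == 0); case: (alpha == 1);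
  case: (beta == 1); case: (gamma == 1); case: (alpha + 2 == 0).
Qed.

End SystemTheory.

(* Main.v *)
Require Import Defs.
From mathcomp Require Import all_boot all_fingroup all_algebra ring zify.
Import GRing.Theory.

Set Implicit Arguments.
Unset Strict Implicit.
Unset Printing Implicit Defensive.

(* [Q] of the 2-sum is expanded at every edge but [e] of [H] and every edge   *)
(* but [f] of [P]: these expansions commute with the 2-sum.  What remains is  *)
(* a 2-sum of two presentations with one edge each.  In such a presentation   *)
(* the circles without the two arcs of the edge match the four ends of the    *)
(* arrows in one of three ways, and two of the three are refined by whether   *)
(* two vertices or two boundary components share a block.  So there are five  *)
(* states, corresponding to the five operations, and counting circles and     *)
(* blocks shows that up to monomials the 2-sum of states [o] and [t], as well *)
(* as the operation [o] on the state [t], contribute the entry [(o, t)] of    *)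
(* the matrix of the system.  Hence some [F], linear in [H], satisfies both   *)
(* the system and [Q (P (+) H) = \sum_o F o * Q (o at f in P)]; by uniqueness  *)
(* [F] is the given solution, and the last equation is applied at each edge.  *)

(** Circles and blocks are handled as equivalence relations on marked points: circles are the
    classes generated by two involutions, and [same_block] is a coarser relation on the same points.
    Operations and 2-sums keep the marked points, rewire the arcs at the tips of one edge, and
    change the block relations only by joining prescribed pairs of points ([op_spec],
    [two_sum_vpart], [two_sum_bpart]). Joins commute, so an operation at another edge commutes with
    the 2-sum ([op_two_suml], [op_two_sumr]). A join lowers the number of classes by one unless the
    points were already related ([nclass_join]), and all counting rests on this.

    With one edge left, the circles without the two arcs of the edge fall into two strands and some
    closed circles. The strands pair the four tips by a translation of (Z/2)^2, and there are three
    nonzero translations ([strand_matched]). Closing one pairing by another gives two circles if the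
    pairings agree and one otherwise, whether the second pairing comes from an operation or from the
    strands of another presentation. Blocks behave likewise. Therefore performing [o] on state [t]
    and 2-summing states [o] and [t] give the same entry [pairing o t], up to monomials.

    By linearity every [H] has coefficients [F] satisfying both the system and the rule that
    replaces a 2-sum at [f] by five operations at [f] ([edge_coefP]). Uniqueness identifies [F] with
    the given solution. Applying the rule at each edge of [P] turns the tensor product into the
    recursion of [Q] with parameters [F] ([Q_two_sums], [mixed_all]). *)

Local Notation equiv_rel := Defs.equiv_rel.

(** * Classes of equivalence relations *)

Section Classes.
Variable T : finType.
Implicit Types (r : rel T) (p q x y : T).

Definition rel_class r x : {set T} := [set y | r x y].
Definition nclass r := #|[set rel_class r x | x : T]|.

Lemma equiv_congr r x y z : equiv_rel r -> r x y -> r x z = r y z.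
Proof.
case=> _ rs rt xy; apply/idP/idP => [|yz]; last exact: rt xy yz.
by apply: rt; rewrite rs.
Qed.

Lemma eq_nclass r r' : r =2 r' -> nclass r = nclass r'.
Proof.
move=> rr'; congr #|pred_of_set _|; apply: eq_imset => x.
by apply/setP=> y; rewrite !inE rr'.
Qed.

Lemma rel_class_eq r x y : equiv_rel r -> (rel_class r x == rel_class r y) = r x y.
Proof.
move=> er; have [rr rs _] := er; apply/eqP/idP => [/setP/(_ y)|xy].
  by rewrite !inE rr.
by apply/setP=> z; rewrite !inE (equiv_congr _ er xy).
Qed.

Lemma nclass_gt0 r (x : T) : 0 < nclass r.
Proof. by apply/card_gt0P; exists (rel_class r x); apply: imset_f. Qed.

(** If [p] and [q] are not related, their two classes are replaced by the union, which is not a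
    class of [r], and all other classes survive. *)
Lemma nclass_join r p q : equiv_rel r ->
  nclass r = nclass (join_rel true r p q) + ~~ r p q.
Proof.
move=> er; have [rr rs rt] := er; have [pq|npq] := boolP (r p q).
  rewrite addn0; apply: eq_nclass => x y; rewrite /join_rel /=.
  have qE z : r z q = r z p by rewrite !(rs z) (equiv_congr _ er pq).
  rewrite !qE !orbb; have [//|/= nxy] := boolP (r x y); symmetry.
  by apply: contraNF nxy => /andP[xp yp]; apply: rt xp _; rewrite rs.
pose N := rel_class r p :|: rel_class r q; pose C := [set rel_class r x | x : T].
have JE x : rel_class (join_rel true r p q) x =
    if r x p || r x q then N else rel_class r x.
  apply/setP=> y; rewrite !inE /join_rel /=; case: ifP => [xpq|_]; last by rewrite inE orbF.
  rewrite !inE (rs p) (rs q); case xy: (r x y) => //=.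
  by move: xpq; rewrite !(equiv_congr _ er xy).
have -> : nclass (join_rel true r p q) =
    #|N |: (C :\ rel_class r p :\ rel_class r q)|.
  congr #|pred_of_set _|; apply/setP=> B; rewrite !inE; apply/imsetP/idP => [[x _ ->]|].
    rewrite JE; case: ifP => [_|/negbT]; first by rewrite eqxx.
    by rewrite negb_or => /andP[xp xq]; rewrite !rel_class_eq // xp xq imset_f ?orbT.
  case/orP=> [/eqP->|/and3P[Bq Bp /imsetP[x _ Bx]]]; first by exists p; rewrite // JE rr.
  exists x => //; rewrite JE; move: Bq Bp; rewrite Bx !rel_class_eq //.
  by move=> /negbTE-> /negbTE->.
have NC : N \notin C.
  apply: contra npq => /imsetP[x _ /setP Nx].
  have := Nx p; have := Nx q; rewrite !inE !rr orbT /= => /esym xq /esym xp.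
  by apply: rt xq; rewrite rs.
have qC : rel_class r q \in C :\ rel_class r p.
  by rewrite !inE rel_class_eq // rs npq imset_f.
have pC : rel_class r p \in C by apply: imset_f.
rewrite cardsU1 !inE (negbTE NC) !andbF /= addnC addnA /nclass -/C.
by rewrite (cardsD1 (rel_class r p)) pC (cardsD1 (rel_class r q)) qC.
Qed.

Lemma nclass_part (X : {set {set T}}) (W : {set {set {set T}}}) :
  partition X setT -> partition W X -> #|W| = nclass (same_block W).
Proof.
move=> pX pW; have [_ ci] := partition_partition pX pW.
rewrite -(card_in_imset ci); congr #|pred_of_set _|.
have cl B x : B \in W -> x \in cover B -> rel_class (same_block W) x = cover B.
  move=> BW xB; apply/setP=> y; rewrite inE; apply/same_blockP/idP => [[B' [BW' xB' yB']]|yB].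
    by rewrite (block_inj pX pW BW BW' xB xB').
  by exists B.
apply/setP=> C; apply/imsetP/imsetP => [[B BW ->]|[x _ ->]].
  have [w wB] : exists w, w \in B by apply/set0Pn; apply: partition_neq0 pW BW.
  have wX : w \in X by apply/subsetP: w wB; apply: partitionS pW _.
  have [x xw] : exists x, x \in w by apply/set0Pn; apply: partition_neq0 pX wX.
  by exists x => //; rewrite (cl B) //; apply/bigcupP; exists w.
by have [B BW xB] := block_ex pX pW x; exists B; rewrite ?(cl B).
Qed.

(** A circle of [Y] belongs to a block as soon as one of its points lies in the cover of the block.
    So blocks whose covers are the classes of [r] are automatically disjoint. *)
Lemma partition_same_block (Y : {set {set T}}) (G : {set {set {set T}}}) r :
    partition Y setT ->
    (forall B, B \in G -> B \subset Y) -> set0 \notin G ->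
    (forall B x z, B \in G -> x \in cover B -> (z \in cover B) = r x z) ->
    (forall x, exists2 B, B \in G & x \in cover B) ->
  partition G Y /\ same_block G =2 r.
Proof.
move=> pY sGY G0 Gr Gx; have tY := partition_trivIset pY.
have memB B w x : B \in G -> w \in Y -> x \in w -> (w \in B) = (x \in cover B).
  move=> BG wY xw; apply/idP/bigcupP => [wB|[w' wB xw']]; first by exists w.
  rewrite -(def_pblock tY wY xw) (def_pblock tY _ xw') //.
  by apply: (subsetP (sGY B BG)).
have ne w : w \in Y -> exists x, x \in w.
  by move=> wY; apply/set0Pn; apply: partition_neq0 pY wY.
split; last first.
  move=> x z; apply/same_blockP/idP => [[B [BG xB zB]]|xz]; first by rewrite -(Gr B).
  by have [B BG xB] := Gx x; exists B; split=> //; rewrite (Gr B x).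
apply/and3P; split=> //.
  apply/eqP/setP=> w; apply/bigcupP/idP => [[B BG]|wY].
    by apply: (subsetP (sGY B BG)).
  have [x xw] := ne w wY; have [B BG xB] := Gx x.
  by exists B => //; rewrite (memB B w x).
apply/trivIsetP => A B AG BG; apply: contraR => /pred0Pn[w /andP[/= wA wB]].
have [x xw] : exists x, x \in w by apply: ne; apply: (subsetP (sGY A AG)).
have xA : x \in cover A by apply/bigcupP; exists w.
have xB : x \in cover B by apply/bigcupP; exists w.
have AB z : (z \in cover A) = (z \in cover B) by rewrite (Gr A x) // (Gr B x).
apply/eqP/setP=> w'; have [w'Y|w'Y] := boolP (w' \in Y).
  by have [y yw'] := ne _ w'Y; rewrite (memB A w' y) // (memB B w' y).
by apply/idP/idP => h; case/negP: w'Y; [apply: (subsetP (sGY A AG))|apply: (subsetP (sGY B BG))].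
Qed.

End Classes.

(** * Disjoint sums of relations *)

Section SumRel.
Variables T T' : finType.
Definition sum_rel (r : rel T) (r' : rel T') : rel (T + T') := fun x y =>
  match x, y with
  | inl x, inl y => r x y
  | inr x, inr y => r' x y
  | _, _ => false
  end.

Lemma sum_rel_equiv r r' : equiv_rel r -> equiv_rel r' -> equiv_rel (sum_rel r r').
Proof.
case=> rr rs rt [rr' rs' rt']; split.
- by case=> x; [apply: rr | apply: rr'].
- by case=> x [y|y] //; [apply: rs | apply: rs'].
- by case=> y [x|x] [z|z] //; [apply: rt | apply: rt'].
Qed.

Lemma eq_sum_rel r1 r2 r1' r2' :
  r1 =2 r2 -> r1' =2 r2' -> sum_rel r1 r1' =2 sum_rel r2 r2'.
Proof. by move=> rr rr' [x|x] [y|y] /=. Qed.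

Lemma sum_rel_joinl w r r' p q :
  sum_rel (join_rel w r p q) r' =2 join_rel w (sum_rel r r') (inl p) (inl q).
Proof. by move=> [x|x] [y|y] //=; rewrite /join_rel /= ?orbF ?andbF ?orbF. Qed.

Lemma sum_rel_joinr w r r' p q :
  sum_rel r (join_rel w r' p q) =2 join_rel w (sum_rel r r') (inr p) (inr q).
Proof. by move=> [x|x] [y|y] //=; rewrite /join_rel /= ?orbF ?andbF ?orbF. Qed.

(** By reflexivity of [r] a class on the left contains a left point, which no class on the right
    does; so the two families of classes do not overlap. *)
Lemma nclass_sum r r' : equiv_rel r ->
  nclass (sum_rel r r') = nclass r + nclass r'.
Proof.
case=> rr _ _; rewrite /nclass; set C := [set _ | _ in _ : {pred T}]; set C' := [set _ | _ in _ : {pred T'}].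
pose f (B : {set T}) : {set T + T'} := inl @: B.
pose f' (B : {set T'}) : {set T + T'} := inr @: B.
have fi : injective f by apply/imset_inj/inl_inj.
have fi' : injective f' by apply/imset_inj/inr_inj.
have cl x : rel_class (sum_rel r r') (inl x) = f (rel_class r x).
  apply/setP=> -[y|y]; rewrite !inE /=; last by symmetry; apply/imsetP => -[].
  by rewrite mem_imset ?inE //; apply: inl_inj.
have cr x : rel_class (sum_rel r r') (inr x) = f' (rel_class r' x).
  apply/setP=> -[y|y]; rewrite !inE /=; first by symmetry; apply/imsetP => -[].
  by rewrite mem_imset ?inE //; apply: inr_inj.
have -> : [set rel_class (sum_rel r r') x | x : T + T'] = (f @: C) :|: (f' @: C').
  apply/setP=> B; rewrite !inE; apply/imsetP/orP => [[[x|x] _ ->]|[]].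
  - by left; rewrite cl; apply/imset_f/imset_f.
  - by right; rewrite cr; apply/imset_f/imset_f.
  - by case/imsetP=> _ /imsetP[x _ ->] ->; exists (inl x); rewrite ?cl.
  - by case/imsetP=> _ /imsetP[x _ ->] ->; exists (inr x); rewrite ?cr.
rewrite cardsU (card_imset _ fi) (card_imset _ fi').
suff -> : f @: C :&: f' @: C' = set0 by rewrite cards0 subn0.
apply/setP=> B; rewrite !inE; apply/negP => /andP[/imsetP[_ /imsetP[x _ ->] ->]].
case/imsetP=> A _ /setP/(_ (inl x)); rewrite mem_imset ?inE ?rr; last exact: inl_inj.
by move/esym/imsetP=> [].
Qed.

End SumRel.

(** * Circles cut at the ends of two arrows *)

Notation crel f g := (connect (circle_rel f g)).

Section Crel.
Variable T : finType.
Implicit Types (f g a : T -> T) (E : rel T) (x y : T).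

Lemma crel_equiv f g : involutive f -> involutive g -> equiv_rel (crel f g).
Proof.
move=> fK gK; split; [exact: connect0 | | exact: connect_trans].
exact/sym_connect_sym/circle_rel_sym.
Qed.

Lemma crel1 f g x : crel f g x (f x).
Proof. by apply: connect1; rewrite /circle_rel eqxx. Qed.

Lemma crel2 f g x : crel f g x (g x).
Proof. by apply: connect1; rewrite /circle_rel eqxx orbT. Qed.

Lemma crel_ind f g (Z : pred T) x :
    (forall y, Z y -> Z (f y)) -> (forall y, Z y -> Z (g y)) -> Z x ->
  forall y, crel f g x y -> Z y.
Proof.
move=> Zf Zg Zx y /connectP[s]; elim/last_ind: s y => [|s z IHs] y /=; first by move=> _ ->.
rewrite rcons_path last_rcons => /andP[xs sz] ->; have Zs := IHs _ xs erefl.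
by case/orP: sz => /eqP->; [apply: Zf | apply: Zg].
Qed.

Lemma crel_min f g E : equiv_rel E -> (forall x, E x (f x)) -> (forall x, E x (g x)) ->
  subrel (crel f g) E.
Proof.
move=> [Er Es Et] Ef Eg x y; apply: crel_ind => // z xz; first exact: Et xz (Ef z).
exact: Et xz (Eg z).
Qed.

Lemma card_circles f g : #|circles f g| = nclass (crel f g).
Proof. by []. Qed.

(** Opens the circles at [S]: the fixed points of the new involution are the ends of the resulting
    strands. *)
Definition cut (S : pred T) a x := if S x then x else a x.

Lemma cutK S a : involutive a -> (forall x, S (a x) = S x) -> involutive (cut S a).
Proof. by move=> aK Sa x; rewrite /cut; case Sx: (S x); rewrite ?Sa Sx. Qed.

Lemma cut_fix (S : pred T) a x : (forall x, a x != x) -> (cut S a x == x) = S x.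
Proof. by move=> an; rewrite /cut; case: ifP => _; rewrite ?eqxx ?(negbTE (an x)). Qed.

(* The circle of a fixed point [t] of [a] is an orbit of the dihedral group   *)
(* generated by [a] and [g]: with [s k := (a \o g)^k t], [a] maps [s k] to    *)
(* [s (n - k)] and [g] maps [s k] to [s (n - k - 1)], where [n] is the length *)
(* of the orbit.  As [g] has no fixed point, [n] is even.                     *)
Lemma second_fixpoint a g t :
    involutive a -> involutive g -> (forall x, g x != x) -> a t = t ->
  exists s, [/\ s != t, a s = s, crel a g t s
    & forall s', crel a g t s' -> a s' = s' -> s' = t \/ s' = s].
Proof.
move=> aK gK gn at_; pose h x := a (g x).
have hi : injective h by apply: inj_comp; apply: inv_inj.
pose n := fingraph.order h t; pose s k := iter k h t.
have sn : s n = t by apply: fingraph.iter_order.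
have as_ k : k <= n -> a (s k) = s (n - k).
  elim: k => [|k IHk] kn; first by rewrite subn0 sn.
  apply: hi; rewrite -[h (s (n - k.+1))]/(s (n - k.+1).+1) subnSK // -IHk 1?ltnW //.
  by rewrite /s iterS /h aK gK.
have gs k : k < n -> g (s k) = s (n - k.+1).
  by move=> kn; rewrite -as_ // /s iterS /h aK.
have n_gt0 : 0 < n by apply: fingraph.order_gt0.
have s_inj i j : i < n -> j < n -> s i = s j -> i = j.
  by move=> li lj sij; rewrite -(findex_iter li) -(findex_iter lj) -/(s i) sij.
have cls x : crel a g t x -> exists2 k, k < n & x = s k.
  move=> tx; suff /existsP[k /eqP->] : [exists k : 'I_n, x == s k] by exists k.
  apply: (crel_ind (Z := fun x => [exists k : 'I_n, x == s k])) tx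
    => [y /existsP[k /eqP->]|y /existsP[k /eqP->]|].
  - have [k0|k_gt0] := posnP k; first by apply/existsP; exists k; rewrite k0 [s 0]/= at_.
    have kn : n - k < n by rewrite -subn_gt0 subKn // ltnW.
    by apply/existsP; exists (Ordinal kn); rewrite as_ // ltnW.
  - have kn : n - k.+1 < n by rewrite -subn_gt0 subKn.
    by apply/existsP; exists (Ordinal kn); rewrite gs.
  - by apply/existsP; exists (Ordinal n_gt0).
have crel_s k : crel a g t (s k).
  elim: k => [|k IHk]; first exact: connect0.
  exact: connect_trans (connect_trans IHk (crel2 _ _ _)) (crel1 _ _ _).
(* In an orbit of odd length [g] would fix the middle point. *)
have n_even : n = n./2.*2.
  rewrite -{1}(odd_double_half n); case no: (odd n) => //.
  have ln : n./2 < n by rewrite -{2}(odd_double_half n) no add1n ltnS -addnn leq_addr.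
  have /eqP := gs _ ln; suff -> : n - n./2.+1 = n./2 by rewrite (negbTE (gn _)).
  by rewrite -{1}(odd_double_half n) no add1n subSS -addnn addnK.
have h_gt0 : 0 < n./2 by rewrite -double_gt0 -n_even.
have ln : n./2 < n by rewrite {2}n_even -addnn -{1}[n./2]addn0 ltn_add2l.
(* Since [a] reverses the orbit, a fixed [s k] has [k = n - k] modulo [n]: either [k = 0], which is
   [t], or [k] is half of [n]. *)
exists (s n./2); split=> //.
- by apply/eqP => /(s_inj _ 0 ln n_gt0) h0; rewrite h0 in h_gt0.
- by rewrite as_ 1?ltnW //; congr s; rewrite {1}n_even -addnn addnK.
move=> x /cls[k kn ->]; rewrite as_ 1?ltnW // => sk.
have [->|k_gt0] := posnP k; [by left | right; congr s].
have nk : n - k = k by apply: s_inj => //; rewrite -subn_gt0 subKn // ltnW.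
by rewrite -[n](subnK (ltnW kn)) nk addnn doubleK.
Qed.

End Crel.

(* The tips [p i h] are matched in pairs differing by [k]. *)
Definition matched (k : bool * bool) (T : eqType) (r : rel T) (p : bool -> bool -> T) :=
  forall i h i' h', r (p i h) (p i' h') =
    ((i (+) i', h (+) h') == (false, false)) || ((i (+) i', h (+) h') == k).

Section Matching.
Variables (T : finType) (a g : T -> T) (p : bool -> bool -> T).
Hypotheses (aK : involutive a) (gK : involutive g) (gn : forall x, g x != x).
Hypothesis a_fix : forall x, a x = x <-> exists i h, x = p i h.
Hypothesis p_inj : forall i h i' h', p i h = p i' h' -> i = i' /\ h = h'.

(** By [second_fixpoint] the strands pair the four tips perfectly. Every perfect matching of (Z/2)^2
    is the translation by a nonzero vector, so one [k] serves all tips. *)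
Lemma matching : exists2 k : bool * bool, k.1 || k.2 & matched k (crel a g) p.
Proof.
have [rr rs _] := crel_equiv aK gK.
have mate i h : exists k : bool * bool, (k.1 || k.2) /\
    forall i' h', crel a g (p i h) (p i' h') =
      ((i (+) i', h (+) h') == (false, false)) || ((i (+) i', h (+) h') == k).
  have [|s [st sa ts sP]] := second_fixpoint (t := p i h) aK gK gn.
    by apply/a_fix; exists i, h.
  have [j [l sE]] := (a_fix s).1 sa; exists (i (+) j, h (+) l); split.
    rewrite sE in st; apply: contraR st; case: (i) (j) (h) (l) => [] [] [] [] //= _.
  move=> i' h'; apply/idP/idP => [|/orP[]/eqP[]].
  - move/sP=> /(_ ((a_fix _).2 _))[|/p_inj[-> ->]|]; first by exists i', h'.
      by rewrite !addbb.
    by rewrite sE => /p_inj[-> ->]; rewrite eqxx orbT.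
  - move=> i0 h0; have -> : i' = i by move: i0; case: (i) (i') => [] [].
    by have -> : h' = h by [move: h0; case: (h) (h') => [] []]; apply: rr.
  - by move=> /addbI-> /addbI->; rewrite -sE.
(* The shifts found at the four tips could differ a priori; symmetry of the relation makes them
   agree, by inspection of all cases. *)
have [k0 [n0 m0]] := mate false false; have [k1 [n1 m1]] := mate false true.
have [k2 [n2 m2]] := mate true false; have [k3 [n3 m3]] := mate true true.
exists k0 => // i h i' h'.
have := rs (p false false) (p false true); have := rs (p false false) (p true false).
have := rs (p false false) (p true true); have := rs (p false true) (p true false).
have := rs (p false true) (p true true); have := rs (p true false) (p true true).
case: i h => [] [] /=; rewrite ?m0 ?m1 ?m2 ?m3.
all: case: k0 n0 {m0} => [] [] [] //= _; case: k1 n1 {m1} => [] [] [] //= _;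
  case: k2 n2 {m2} => [] [] [] //= _; case: k3 n3 {m3} => [] [] [] //= _.
Qed.

End Matching.

(** * Gluing partitions *)

Section Glue.
Variable D : finType.
Implicit Types (X Y Z B S : {set {set D}}) (u v : {set D}) (x y z : D).

Lemma coverU X Y : cover (X :|: Y) = cover X :|: cover Y.
Proof. exact: bigcup_setU. Qed.

Lemma cover_set2 u v : cover [set u; v] = u :|: v.
Proof. by rewrite coverU !cover1. Qed.

Lemma cover_replace B Z S :
  Z \subset B -> cover S = cover Z -> cover (B :\: Z :|: S) = cover B.
Proof.
by move=> ZB SZ; rewrite coverU SZ -coverU setUC -{1}(setIidPr ZB) setID.
Qed.

Variables (X Y S1 S2 : {set {set D}}) (W : {set {set {set D}}}).
Variables (u v u' v' : {set D}) (x1 x2 y1 y2 : D).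
Hypotheses (pX : partition X setT) (pY : partition Y setT) (pW : partition W X).
Hypotheses (uX : u \in X) (vX : v \in X) (uX' : u' \in X) (vX' : v' \in X).
Hypotheses (x1u : x1 \in u) (x2v : x2 \in v) (y1u : y1 \in u') (y2v : y2 \in v').
Hypothesis sXY : X :\: [set u; u'; v; v'] \subset Y.
Hypotheses (sS1 : S1 \subset Y) (sS2 : S2 \subset Y).
Hypotheses (S1n : S1 != set0) (S2n : S2 != set0).
Local Notation sb := (same_block W).
Hypotheses (d11 : ~~ sb x1 y1) (d12 : ~~ sb x1 y2) (d21 : ~~ sb x2 y1) (d22 : ~~ sb x2 y2).
Hypothesis cS : cover (S1 :|: S2) = cover [set u; u'; v; v'].
Hypothesis cS12 : ~~ sb x1 x2 -> ~~ sb y1 y2 ->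
  cover S1 = u :|: u' /\ cover S2 = v :|: v'.

(** The created circles cover exactly the points of the circles they replace, so a glued block
    covers the union of the blocks it comes from, and the block relation gains just the two joins.
    If the blocks on one side coincide, the joins produce one class, in accordance with the
    conditional in [glue], and only the total cover matters; otherwise [cS12] supplies the covers of
    [S1] and [S2] separately. *)
Lemma glue_spec :
  partition (glue W u v u' v' S1 S2) Y /\
  same_block (glue W u v u' v' S1 S2) =2
    join_rel true (join_rel true sb x1 y1) x2 y2.
Proof.
have cW := cover_partition pW.
have er : equiv_rel sb.
  by split; [exact: same_block_refl pX pW | exact: same_block_sym
         | exact: same_block_trans pX pW].
have [rr rs rt] := er.
rewrite /glue; set bu := pblock W u; set bv := pblock W v.
set bu' := pblock W u'; set bv' := pblock W v'.
have blockE w t : w \in X -> t \in w -> [/\ w \in pblock W w, pblock W w \in W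
    & forall z, (z \in cover (pblock W w)) = sb z t].
  move=> wX tw; have ww : w \in pblock W w by rewrite mem_pblock cW.
  have wW : pblock W w \in W by rewrite pblock_mem ?cW.
  have tc : t \in cover (pblock W w) by apply/bigcupP; exists w.
  split=> // z; apply/idP/same_blockP => [zw|[B [BW zB tB]]]; first by exists (pblock W w).
  by rewrite (block_inj pX pW wW BW tc tB).
have [ubu buW buE] := blockE _ _ uX x1u; have [vbv bvW bvE] := blockE _ _ vX x2v.
have [ubu' buW' buE'] := blockE _ _ uX' y1u; have [vbv' bvW' bvE'] := blockE _ _ vX' y2v.
rewrite -/bu -/bv -/bu' -/bv' in ubu buW buE vbv bvW bvE ubu' buW' buE' vbv' bvW' bvE'.
have eqb t t' (b b' : {set {set D}}) : b \in W -> b' \in W -> (forall z, (z \in cover b) = sb z t) ->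
    (forall z, (z \in cover b') = sb z t') -> (b == b') = sb t t'.
  move=> bW bW' bE bE'; apply/eqP/idP => [bb|tt'].
    by rewrite -bE' -bb bE rr.
  by apply: (block_inj pX pW bW bW' (x := t)); rewrite ?bE ?bE' ?rr.
rewrite (eqb _ _ _ _ buW bvW buE bvE).
rewrite (eqb _ _ _ _ buW' bvW' buE' bvE').
set G := _ :|: _; set E := join_rel _ _ _ _.
have subX b : b \in W -> b \subset X by move=> bW; apply: partitionS pW bW.
(* The other blocks survive: none of their circles is replaced and none of their points is
   joined. *)
have oldE B : B \in W -> B \notin [set bu; bv; bu'; bv'] ->
    B \subset Y /\ forall x z, x \in cover B -> (z \in cover B) = E x z.
  move=> BW Bn; have out (w : {set D}) (b : {set {set D}}) :
      w \in b -> b \in W -> b \in [set bu; bv; bu'; bv'] -> w \notin B.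
    move=> wb bW bin; apply: contraNN Bn => wB; rewrite -(def_pblock _ BW wB)
      ?(def_pblock _ bW wb) //;
    exact: partition_trivIset pW.
  split.
    apply/subsetP=> w wB; apply: (subsetP sXY); rewrite in_setD (subsetP (subX B BW)) // andbT.
    rewrite !inE !negb_or -!andbA; apply/and4P; split; apply: contraTneq wB => ->;
    [apply: (out _ bu)|apply: (out _ bu')|apply: (out _ bv)|apply: (out _ bv')];
    by rewrite // !inE eqxx ?orbT.
  move=> x z xB; have far (b : {set {set D}}) t : b \in W -> b \in [set bu; bv; bu'; bv'] ->
      (forall z, (z \in cover b) = sb z t) -> sb x t = false.
      move=> bW bin bE; apply: contraNF Bn; rewrite -bE => xb.
    by rewrite (block_inj pX pW BW bW xB xb).
  rewrite /E /join_rel /= (far bu x1) ?(far bu' y1) ?(far bv x2) ?(far bv' y2) ?inE ?eqxx ?orbT //=.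
  rewrite !orbF; apply/idP/same_blockP => [zB|[B' [BW' xB' zB']]]; first by exists B.
  by rewrite (block_inj pX pW BW BW' xB xB').
have bn (w : {set D}) (b b' : {set {set D}}) t t' :
    b' \in W -> w \in b' -> (forall z, (z \in cover b) = sb z t) ->
    (forall z, (z \in cover b') = sb z t') -> ~~ sb t t' -> w \notin b.
  move=> bW' wb' bE bE'; apply: contra => wb.
  have /set0Pn[z zw] : w != set0.
    by apply: partition_neq0 pX _; apply: (subsetP (subX b' bW')).
  have zt : sb z t by rewrite -bE; apply/bigcupP; exists w.
  have zt' : sb z t' by rewrite -bE'; apply/bigcupP; exists w.
  by apply: rt zt'; rewrite rs.
have sb_eq x z t : sb x z -> sb z t = sb x t by move=> xz; rewrite (equiv_congr _ er xz).
suff [GY Gn GE Gx] : [/\ forall B, B \in G -> B \subset Y, set0 \notin G,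
    (forall B x z, B \in G -> x \in cover B -> (z \in cover B) = E x z) &
    (forall x, exists2 B, B \in G & x \in cover B)].
  exact: partition_same_block.
have no_set0 B S : S != set0 -> B :|: S != set0.
  by case/set0Pn=> w wS; apply/set0Pn; exists w; rewrite inE wS orbT.
have W0 : set0 \notin W by apply/negP => /(partition_neq0 pW); rewrite eqxx.
have oldx x : [|| sb x x1, sb x x2, sb x y1 | sb x y2] \/
    exists2 B, B \in W :\: [set bu; bv; bu'; bv'] & x \in cover B.
  have [B BW xB] := block_ex pX pW x.
  have [Bin|Bn] := boolP (B \in [set bu; bv; bu'; bv']); last by right; exists B; rewrite // inE Bn.
  left; move: Bin xB; rewrite !inE => /orP[/orP[/orP[]|]|] /eqP->;
  by rewrite ?buE ?bvE ?buE' ?bvE' => ->; rewrite ?orbT.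
move: @G; case: ifP => [same|/negbT]; last first.
  rewrite negb_or => /andP[nx ny]; have [c1 c2] := cS12 nx ny.
  set N1 := _ :|: S1; set N2 := _ :|: S2 => G.
  have c1' : cover S1 = cover [set u; u'] by rewrite c1 cover_set2.
  have c2' : cover S2 = cover [set v; v'] by rewrite c2 cover_set2.
  have N1E z : (z \in cover N1) = sb z x1 || sb z y1.
    rewrite cover_replace // ?coverU ?inE ?buE ?buE' //.
    by apply/subsetP=> w; rewrite !inE => /orP[]/eqP->; rewrite ?ubu ?ubu' ?orbT.
  have N2E z : (z \in cover N2) = sb z x2 || sb z y2.
    rewrite cover_replace // ?coverU ?inE ?bvE ?bvE' //.
    by apply/subsetP=> w; rewrite !inE => /orP[]/eqP->; rewrite ?vbv ?vbv' ?orbT.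
  have nx' : ~~ sb x2 x1 by rewrite rs. have ny' : ~~ sb y2 y1 by rewrite rs.
  have e11 : ~~ sb y1 x1 by rewrite rs. have e12 : ~~ sb y2 x1 by rewrite rs.
  have e21 : ~~ sb y1 x2 by rewrite rs. have e22 : ~~ sb y2 x2 by rewrite rs.
  have EE x z : E x z = [|| sb x z, (sb x x1 || sb x y1) && (sb z x1 || sb z y1)
      | (sb x x2 || sb x y2) && (sb z x2 || sb z y2)].
    rewrite /E /join_rel /= (negbTE nx') (negbTE d21) (negbTE e12) (negbTE ny') /=.
    by rewrite !andbF !orbF -!orbA.
  have sep x : (sb x x1 || sb x y1) -> (sb x x2 || sb x y2) = false.
    by case/orP => xt; rewrite -!(equiv_congr _ er (etrans (rs _ _) xt))
      ?(negbTE nx) ?(negbTE d12) ?(negbTE e21) ?(negbTE ny).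
  have inY (b b' : {set {set D}}) (w : {set D}) : b \in W -> b' \in W ->
      w \in (b :|: b') -> w \notin [set u; u'; v; v'] -> w \in Y.
    move=> bW bW' wb wn; apply: (subsetP sXY); rewrite in_setD wn.
    by case/setUP: wb; apply/subsetP/subX.
  have vbu : v \notin bu by apply: (bn _ bu bv x1 x2).
  have vbu' : v \notin bu' by apply: (bn _ bu' bv y1 x2).
  have vbu2 : v' \notin bu by apply: (bn _ bu bv' x1 y2).
  have vbu2' : v' \notin bu' by apply: (bn _ bu' bv' y1 y2).
  have ubv : u \notin bv by apply: (bn _ bv bu x2 x1).
  have ubv' : u \notin bv' by apply: (bn _ bv' bu y2 x1).
  have ubv2 : u' \notin bv by apply: (bn _ bv bu' x2 y1).
  have ubv2' : u' \notin bv' by apply: (bn _ bv' bu' y2 y1).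
  split.
  - move=> B; rewrite 2!inE => /orP[/andP[Bn BW]|]; first by case: (oldE B BW Bn).
    rewrite in_set2 => /orP[]/eqP->; rewrite /N1 /N2 subUset ?sS1 ?sS2 andbT;
    apply/subsetP=> w; rewrite in_setD => /andP[wn wN]; move: (wn);
    rewrite !inE negb_or => /andP[w1 w2].
      apply: (inY bu bu') => //; rewrite !inE (negbTE w1) (negbTE w2) /=.
      by apply: contraTN wN => /orP[]/eqP->; rewrite inE negb_or ?vbu ?vbu2.
    apply: (inY bv bv') => //; rewrite !inE (negbTE w1) (negbTE w2) /= !orbF.
    by apply: contraTN wN => /orP[]/eqP->; rewrite inE negb_or ?ubv ?ubv2.
  - rewrite in_setU negb_or in_setD (negbTE W0) andbF /= in_set2 negb_or ![set0 == _]eq_sym.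
    by rewrite !no_set0.
  - move=> B x z; rewrite 2!inE => /orP[/andP[Bn BW]|]; first by case: (oldE B BW Bn) => _ h /h.
    have sx := sep x; have sz := sep z.
    have [xz|nxz] := boolP (sb x z).
      have sbz t := sb_eq x z t xz.
      by rewrite in_set2 EE xz /= => /orP[]/eqP->; rewrite ?N1E ?N2E !sbz.
    rewrite in_set2 EE (negbTE nxz) /= => /orP[]/eqP->; rewrite ?N1E ?N2E => xN.
      by rewrite xN (sx xN) orbF.
    by rewrite xN; case xN1 : (sb x x1 || sb x y1) => //; rewrite sx in xN.
  - move=> x; have [x4|[B]] := oldx x; last by move=> BG; exists B => //; rewrite inE BG.
    have [x1_|] := boolP (sb x x1 || sb x y1).
      by exists N1; rewrite ?N1E // !inE eqxx ?orbT.
    rewrite negb_or => /andP[n1 n2]; exists N2; last first.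
      by rewrite N2E; move: x4; rewrite (negbTE n1) (negbTE n2).
    by rewrite !inE eqxx ?orbT.
set N := _ :|: (S1 :|: S2) => G.
have NE z : (z \in cover N) = [|| sb z x1, sb z y1, sb z x2 | sb z y2].
  rewrite cover_replace // ?coverU ?inE ?buE ?buE' ?bvE ?bvE' -?orbA //.
  apply/subsetP=> w; rewrite !inE -!orbA.
  by case/or4P=> /eqP->; rewrite ?ubu ?ubu' ?vbv ?vbv' ?orbT.
split.
- move=> B; rewrite 2!inE => /orP[/andP[Bn BW]|]; first by case: (oldE B BW Bn).
  rewrite inE => /eqP->; rewrite !subUset sS1 sS2 !andbT.
  apply/subsetP=> w; rewrite in_setD => /andP[wn wN]; apply: (subsetP sXY).
  rewrite in_setD wn; move: wN; rewrite !inE -!orbA.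
  by case/or4P; apply/subsetP/subX.
- rewrite in_setU negb_or in_setD (negbTE W0) andbF /= in_set1 eq_sym no_set0 //.
  by case/set0Pn: S1n => w wS; apply/set0Pn; exists w; rewrite inE wS.
- move=> B x z; rewrite 2!inE => /orP[/andP[Bn BW]|]; first by case: (oldE B BW Bn) => _ h /h.
  rewrite inE => /eqP->; rewrite !NE.
  have [xz|nxz] := boolP (sb x z).
    have sbz t := sb_eq x z t xz.
    by rewrite /E (join_rel_sub true x2 y2 (join_rel_sub true x1 y1 xz)) !sbz.
  rewrite /E /join_rel /= (negbTE nxz) /=.
  rewrite (rs x2 x1) (rs y2 y1) (rs y2 x1) (negbTE d21) (negbTE d12).
  move: same; case: (sb x1 x2) => /=; case: (sb y1 y2) => //= _;
  case: (sb x x1); case: (sb x x2); case: (sb x y1); case: (sb x y2) => //=;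
  by case: (sb z x1); case: (sb z x2); case: (sb z y1); case: (sb z y2).
- move=> x; have [x4|[B]] := oldx x; last by move=> BG; exists B => //; rewrite inE BG.
  exists N; last by rewrite NE; case/or4P: x4 => ->; rewrite ?orbT.
  by rewrite !inE eqxx ?orbT.
Qed.
End Glue.

(** * Circles and blocks in a disjoint union *)

Lemma imsetU_partition (A B C : finType) (f : A -> C) (h : B -> C)
    (P : {set {set A}}) (P' : {set {set B}}) (E : {set A}) (E' : {set B}) :
    injective f -> injective h -> [disjoint f @: E & h @: E'] ->
    partition P E -> partition P' E' ->
  partition ([set f @: (X : {set A}) | X in P] :|: [set h @: (X : {set B}) | X in P'])
    (f @: E :|: h @: E').
Proof.
move=> fi hi dEE; rewrite -(imset_partition P E fi) -(imset_partition P' E' hi) => pP pP'.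
apply/and3P; split.
- by rewrite coverU (cover_partition pP) (cover_partition pP').
- apply: (trivIsetU (partition_trivIset pP) (partition_trivIset pP')).
  by rewrite (cover_partition pP) (cover_partition pP').
- by rewrite inE (partition0 pP) (partition0 pP').
Qed.

Lemma circle_same_block (T : finType) (f g : T -> T) W x y :
    involutive f -> involutive g -> partition W (circles f g) -> crel f g x y ->
  same_block W x y.
Proof.
move=> fK gK pW xy; have pX := circles_partition fK gK.
have [_ rs rt] := crel_equiv fK gK.
have [B BW xB] := block_ex pX pW x; apply/same_blockP; exists B; split=> //.
case/bigcupP: (xB) => w wB xw; apply/bigcupP; exists w => //.
have /imsetP[z _ wz] : w \in circles f g by apply/subsetP: wB; apply: partitionS pW BW.
by move: xw; rewrite wz !inE => /rt; apply.
Qed.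

(** Commutation is asked only along the circle of [x], because the inclusion into a 2-sum does not
    commute with the arcs at the tips. *)
Lemma circle_image (T D : finType) (j : T -> D) (f g : T -> T) (F G : D -> D) x :
    (forall y, crel f g x y -> F (j y) = j (f y)) ->
    (forall y, crel f g x y -> G (j y) = j (g y)) ->
  j @: circle f g x = circle F G (j x).
Proof.
move=> Fj Gj; apply/setP=> y; apply/imsetP/idP => [[y' + ->]|].
  rewrite !inE => xy; suff /andP[] : crel F G (j x) (j y') && crel f g x y' by [].
  apply: (crel_ind (Z := fun y => crel F G (j x) (j y) && crel f g x y)) xy;
    rewrite ?connect0 // => z /andP[Fz az].
    by rewrite (connect_trans az (crel1 _ _ _)) andbT -Fj // (connect_trans Fz) ?crel1.
  by rewrite (connect_trans az (crel2 _ _ _)) andbT -Gj // (connect_trans Fz) ?crel2.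
rewrite inE => xy; suff /imsetP[y' xy' ->] : y \in [set j y | y in circle f g x] by exists y'.
apply: (crel_ind (Z := mem [set j y | y in circle f g x])) xy
  => [_ /imsetP[z xz ->]|_ /imsetP[z xz ->]|];
  last exact/imset_f/mem_circle.
  rewrite inE in xz; rewrite /= Fj // imset_f // inE.
  exact: connect_trans xz (crel1 _ _ _).
rewrite inE in xz; rewrite /= Gj // imset_f // inE.
exact: connect_trans xz (crel2 _ _ _).
Qed.

Section SumBlocks.
Variables T T' : finType.

Definition sum_blocks (V : {set {set {set T}}}) (V' : {set {set {set T'}}}) :
    {set {set {set (T + T')}}} :=
  [set [set inl @: (w : {set _}) | w in X : {set _}] | X in V]
    :|: [set [set inr @: (w : {set _}) | w in X : {set _}] | X in V'].

Definition sum_sets (X : {set {set T}}) (X' : {set {set T'}}) : {set {set (T + T')}} :=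
  [set inl @: (w : {set _}) | w in X] :|: [set inr @: (w : {set _}) | w in X'].

Lemma mem_inl (B : {set T}) x : (inl x \in [set (inl y : T + T') | y in B]) = (x \in B).
Proof. by rewrite mem_imset //; apply: inl_inj. Qed.

Lemma mem_inr (B : {set T'}) x : (inr x \in [set (inr y : T + T') | y in B]) = (x \in B).
Proof. by rewrite mem_imset //; apply: inr_inj. Qed.

Lemma inl_inr (B : {set T'}) x : (inl x \in [set (inr y : T + T') | y in B]) = false.
Proof. by apply/imsetP => -[]. Qed.

Lemma inr_inl (B : {set T}) x : (inr x \in [set (inl y : T + T') | y in B]) = false.
Proof. by apply/imsetP => -[]. Qed.

Definition mem_sum := (mem_inl, mem_inr, inl_inr, inr_inl).

Lemma sum_sets_partition X X' :
  partition X setT -> partition X' setT -> partition (sum_sets X X') setT.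
Proof.
move=> pX pX'.
have -> : [set: T + T'] = (inl @: setT) :|: (inr @: setT).
  by apply/setP=> -[x|x]; rewrite !inE !mem_sum !inE.
apply: imsetU_partition => //; [exact: inl_inj | exact: inr_inj |].
by rewrite -setI_eq0; apply/eqP/setP=> -[x|x]; rewrite !inE !mem_sum ?andbF.
Qed.

Variables (X : {set {set T}}) (X' : {set {set T'}}).
Variables (V : {set {set {set T}}}) (V' : {set {set {set T'}}}).
Hypotheses (pX : partition X setT) (pX' : partition X' setT).
Hypotheses (pV : partition V X) (pV' : partition V' X').

Lemma sum_blocks_partition : partition (sum_blocks V V') (sum_sets X X').
Proof.
apply: imsetU_partition => //; [exact/imset_inj/inl_inj | exact/imset_inj/inr_inj |].
rewrite -setI_eq0; apply/eqP/setP=> w; rewrite !inE; apply/negP => /andP[].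
case/imsetP=> B BX -> /imsetP[B' BX'] /setP eB.
have /set0Pn[x xB] := partition_neq0 pX BX.
by have := eB (inl x); rewrite !mem_sum xB.
Qed.

Lemma cover_inl (B : {set {set T}}) :
  cover [set ([set inl y | y in w] : {set T + T'}) | w : {set T} in B] = inl @: cover B.
Proof.
apply/setP=> -[x|x]; rewrite !mem_sum; last first.
  by apply/bigcupP => -[_ /imsetP[w wB ->]]; rewrite mem_sum.
apply/bigcupP/bigcupP => [[_ /imsetP[w wB ->]]|[w wB xw]].
  by rewrite mem_sum; exists w.
by exists (inl @: w); rewrite ?mem_sum ?imset_f.
Qed.

Lemma cover_inr (B : {set {set T'}}) :
  cover [set ([set inr y | y in w] : {set T + T'}) | w : {set T'} in B] = inr @: cover B.
Proof.
apply/setP=> -[x|x]; rewrite !mem_sum.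
  by apply/bigcupP => -[_ /imsetP[w wB ->]]; rewrite mem_sum.
apply/bigcupP/bigcupP => [[_ /imsetP[w wB ->]]|[w wB xw]].
  by rewrite mem_sum; exists w.
by exists (inr @: w); rewrite ?mem_sum ?imset_f.
Qed.

Lemma same_block_sum :
  same_block (sum_blocks V V') =2 sum_rel (same_block V) (same_block V').
Proof.
move=> x y; apply/same_blockP/idP => [[B [/setUP[]/imsetP[C CV ->]]]|].
- by rewrite cover_inl; case: x y => [x|x] [y|y]; rewrite !mem_sum //= => xC yC;
     apply/same_blockP; exists C.
- by rewrite cover_inr; case: x y => [x|x] [y|y]; rewrite !mem_sum //= => xC yC;
     apply/same_blockP; exists C.
case: x y => [x|x] [y|y] //= /same_blockP[C [CV xC yC]].
  exists [set inl @: (w : {set T}) | w in C]; rewrite cover_inl !mem_sum.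
  by split=> //; apply/setUP; left; apply: imset_f.
exists [set inr @: (w : {set T'}) | w in C]; rewrite cover_inr !mem_sum.
by split=> //; apply/setUP; right; apply: imset_f.
Qed.

End SumBlocks.

(* For the vertices [p i j] is [tip f i j], for the boundary components it is *)
(* [tip f j (i (+) j)]; either way [a] exchanges [p i false] and [p i true].  *)
Section CircleGlue.
Variables (T T' : finType) (a g : T -> T) (a' g' : T' -> T').
Variables (p : bool -> bool -> T) (q : bool -> bool -> T').
Variables F G : T + T' -> T + T'.
Hypotheses (aK : involutive a) (gK : involutive g).
Hypotheses (aK' : involutive a') (gK' : involutive g').
Hypotheses (FK : involutive F) (GK : involutive G).
Hypotheses (ap : forall i j, a (p i j) = p i (~~ j)) (aq : forall i j, a' (q i j) = q i (~~ j)).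
Hypotheses (Fp : forall i j, F (inl (p i j)) = inr (q i j)).
Hypotheses (Fq : forall i j, F (inr (q i j)) = inl (p i j)).
Hypothesis Fl : forall x, (forall i j, x <> p i j) -> F (inl x) = inl (a x).
Hypothesis Fr : forall x, (forall i j, x <> q i j) -> F (inr x) = inr (a' x).
Hypotheses (Gl : forall x, G (inl x) = inl (g x)) (Gr : forall x, G (inr x) = inr (g' x)).

Lemma tip_dec (U : finType) (t : bool -> bool -> U) x :
  (exists i j, x = t i j) \/ (forall i j, x <> t i j).
Proof.
have [/existsP[i /existsP[j /eqP->]]|nx] := boolP [exists i, exists j, x == t i j].
  by left; exists i, j.
by right=> i j xt; case/negP: nx; apply/existsP; exists i; apply/existsP; exists j; apply/eqP.
Qed.

Definition touched (I : pred bool) (z : T + T') :=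
  match z with
  | inl x => [exists i, I i && crel a g (p i false) x]
  | inr x => [exists i, I i && crel a' g' (q i false) x]
  end.

Lemma crel_tip i j : crel a g (p i false) (p i j).
Proof. by case: j; [rewrite -[true]/(~~ false) -ap crel1 | exact: connect0]. Qed.

Lemma crel_tip' i j : crel a' g' (q i false) (q i j).
Proof. by case: j; [rewrite -[true]/(~~ false) -aq crel1 | exact: connect0]. Qed.

(** [F] passes from one side to the other only between [p i j] and [q i j], and [I] is closed under
    lying on a common circle on either side. So the circles of the sum through tips with index in
    [I] fill exactly the old circles through these tips. *)
Lemma touchedE (I : pred bool) :
    (forall i i', I i -> crel a g (p i false) (p i' false) -> I i') ->
    (forall i i', I i -> crel a' g' (q i false) (q i' false) -> I i') ->
  forall z, [exists i, exists j, I i && crel F G (inl (p i j)) z] = touched I z.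
Proof.
move=> Ip Iq; have [_ rs rt] := crel_equiv aK gK; have [_ rs' rt'] := crel_equiv aK' gK'.
have tp i j : touched I (inl (p i j)) -> I i.
  case/existsP=> i0 /andP[I0 c]; apply: (Ip i0) => //; apply: rt c _.
  by rewrite rs crel_tip.
have tq i j : touched I (inr (q i j)) -> I i.
  case/existsP=> i0 /andP[I0 c]; apply: (Iq i0) => //; apply: rt' c _.
  by rewrite rs' crel_tip'.
have tp' i j : I i -> touched I (inl (p i j)).
  by move=> Ii; apply/existsP; exists i; rewrite Ii crel_tip.
have tq' i j : I i -> touched I (inr (q i j)).
  by move=> Ii; apply/existsP; exists i; rewrite Ii crel_tip'.
have ta x : touched I (inl x) -> touched I (inl (a x)).
  case/existsP=> i /andP[Ii c]; apply/existsP; exists i.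
  by rewrite Ii (rt _ _ _ c (crel1 _ _ _)).
have tg x : touched I (inl x) -> touched I (inl (g x)).
  case/existsP=> i /andP[Ii c]; apply/existsP; exists i.
  by rewrite Ii (rt _ _ _ c (crel2 _ _ _)).
have ta' x : touched I (inr x) -> touched I (inr (a' x)).
  case/existsP=> i /andP[Ii c]; apply/existsP; exists i.
  by rewrite Ii (rt' _ _ _ c (crel1 _ _ _)).
have tg' x : touched I (inr x) -> touched I (inr (g' x)).
  case/existsP=> i /andP[Ii c]; apply/existsP; exists i.
  by rewrite Ii (rt' _ _ _ c (crel2 _ _ _)).
pose R z := [exists i, exists j, I i && crel F G (inl (p i j)) z].
have Rp i j : I i -> R (inl (p i j)).
  by move=> Ii; apply/existsP; exists i; apply/existsP; exists j; rewrite Ii connect0.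
have RF z : R z -> R (F z).
  case/existsP=> i /existsP[j /andP[Ii c]]; apply/existsP; exists i; apply/existsP; exists j.
  by rewrite Ii (connect_trans c (crel1 _ _ _)).
have RG z : R z -> R (G z).
  case/existsP=> i /existsP[j /andP[Ii c]]; apply/existsP; exists i; apply/existsP; exists j.
  by rewrite Ii (connect_trans c (crel2 _ _ _)).
move=> z; rewrite -/(R z); apply/idP/idP.
  case/existsP=> i /existsP[j /andP[Ii]]; apply: crel_ind; last exact: tp'.
    case=> x tx.
      have [[i' [j' xE]]|nx] := tip_dec p x; last by rewrite Fl // ta.
      by rewrite xE in tx *; rewrite Fp tq' ?(tp _ _ tx).
    have [[i' [j' xE]]|nx] := tip_dec q x; last by rewrite Fr // ta'.
    by rewrite xE in tx *; rewrite Fq tp' ?(tq _ _ tx).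
  by case=> x tx; rewrite ?Gl ?Gr ?tg ?tg'.
(* Conversely an old circle is followed inside the sum. Its arc from a tip to the next is gone, but
   the other end is again a starting point, or the image of one under [F]. *)
case: z => x /existsP[i /andP[Ii c]].
  suff /andP[] : R (inl x) && touched I (inl x) by [].
  move: x c; apply: crel_ind => [x /andP[Rx tx]|x /andP[Rx tx]|]; last by rewrite Rp ?tp'.
    rewrite ta // andbT; have [[i' [j' xE]]|nx] := tip_dec p x; last by rewrite -Fl ?RF.
    by rewrite xE in tx *; rewrite ap Rp ?(tp _ _ tx).
  by rewrite tg // -Gl RG.
suff /andP[] : R (inr x) && touched I (inr x) by [].
move: x c; apply: crel_ind => [x /andP[Rx tx]|x /andP[Rx tx]|].
- rewrite ta' // andbT; have [[i' [j' xE]]|nx] := tip_dec q x; last by rewrite -Fr ?RF.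
  by rewrite xE in tx *; rewrite aq -Fp RF ?Rp ?(tq _ _ tx).
- by rewrite tg' // -Gr RG.
- by apply/andP; split; [rewrite -Fp RF ?Rp | exact: tq'].
Qed.

Variables (W : {set {set {set T}}}) (W' : {set {set {set T'}}}).
Hypotheses (pW : partition W (circles a g)) (pW' : partition W' (circles a' g')).

(** If on each side the two circles lie in different blocks, they are distinct, so [touchedE]
    applies to each index alone and gives the two covers separately. In any case it applies to both
    indices together. These are the two cover conditions of [glue_spec]. *)
Lemma circle_glue :
  let R := glue (sum_blocks W W') (inl @: circle a g (p false false))
    (inl @: circle a g (p true false)) (inr @: circle a' g' (q false false))
    (inr @: circle a' g' (q true false))
    [set circle F G (inl (p false false)); circle F G (inl (p false true))]
    [set circle F G (inl (p true false)); circle F G (inl (p true true))] in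
  partition R (circles F G) /\
  same_block R =2
    join_rel true
      (join_rel true (sum_rel (same_block W) (same_block W'))
         (inl (p false false)) (inr (q false false)))
      (inl (p true false)) (inr (q true false)).
Proof.
have pX := circles_partition aK gK; have pX' := circles_partition aK' gK'.
have [_ rs rt] := crel_equiv aK gK; have [_ rs' rt'] := crel_equiv aK' gK'.
have sbE := same_block_sum W W'.
have inX x : inl @: circle a g x \in sum_sets (circles a g) (circles a' g').
  by apply/setUP; left; apply/imset_f/mem_circles.
have inX' x : inr @: circle a' g' x \in sum_sets (circles a g) (circles a' g').
  by apply/setUP; right; apply/imset_f/mem_circles.
have S2n (x y : {set T + T'}) : [set x; y] != set0.
  by apply/set0Pn; exists x; rewrite !inE eqxx.
have sS x y : [set circle F G x; circle F G y] \subset circles F G.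
  by apply/subsetP=> w; rewrite in_set2 => /orP[]/eqP->; apply: mem_circles.
have tipsP i j x : crel a g x (p i j) -> x \in circle a g (p i false).
  by move=> c; rewrite inE rs; apply: rt c _; rewrite rs crel_tip.
have tipsQ i j x : crel a' g' x (q i j) -> x \in circle a' g' (q i false).
  by move=> c; rewrite inE rs'; apply: rt' c _; rewrite rs' crel_tip'.
have eqP_ x y : x \in circle a g y -> circle a g x = circle a g y.
  rewrite inE => yx; apply/setP=> z; rewrite !inE; apply/idP/idP => [|yz]; first exact: rt yx.
  by apply: rt yz; rewrite rs.
have eqQ_ x y : x \in circle a' g' y -> circle a' g' x = circle a' g' y.
  rewrite inE => yx; apply/setP=> z; rewrite !inE; apply/idP/idP => [|yz]; first exact: rt' yx.
  by apply: rt' yz; rewrite rs'.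
have touch12 (I : pred bool) (z : T + T') :
    (forall i i', I i -> crel a g (p i false) (p i' false) -> I i') ->
    (forall i i', I i -> crel a' g' (q i false) (q i' false) -> I i') ->
    touched I z = [exists i, exists j, I i && (z \in circle F G (inl (p i j)))].
  move=> Ip Iq; rewrite -touchedE //; apply: eq_existsb => i; apply: eq_existsb => j.
  by rewrite inE.
set u := inl @: _; set v := inl @: _; set u' := inr @: _; set v' := inr @: _.
have sXY : sum_sets (circles a g) (circles a' g') :\: [set u; u'; v; v'] \subset circles F G.
  apply/subsetP=> w; rewrite in_setD => /andP[wn /setUP[]/imsetP[_ /imsetP[x _ ->]] wE].
    have nt y : crel a g x y -> forall i j, y <> p i j.
      move=> xy i j yE; case/negP: wn; rewrite yE in xy.
      by rewrite wE (eqP_ _ _ (tipsP _ _ _ xy)) !inE; case: (i); rewrite eqxx ?orbT.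
    rewrite wE (circle_image (F := F) (G := G)) ?mem_circles // => y xy; rewrite ?Gl ?Fl //.
    exact: nt.
  have nt y : crel a' g' x y -> forall i j, y <> q i j.
    move=> xy i j yE; case/negP: wn; rewrite yE in xy.
    by rewrite wE (eqQ_ _ _ (tipsQ _ _ _ xy)) !inE; case: (i); rewrite eqxx ?orbT.
  rewrite wE (circle_image (F := F) (G := G)) ?mem_circles // => y xy; rewrite ?Gr ?Fr //.
  exact: nt.
set S1 := [set circle F G (inl (p false false)); _]; set S2 := [set _; _].
have existsb (b : pred bool) : [exists i, b i] = b false || b true.
  by apply/existsP/orP => [[[] ->]|[]bi]; [right|left|exists false|exists true].
have cS : cover (S1 :|: S2) = cover [set u; u'; v; v'].
  apply/setP=> z; have := touch12 predT z; rewrite !existsb /= !coverU !cover1 !in_setU => <- //.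
  by case: z => x; rewrite /= existsb !mem_sum !inE /= ?orbF.
have cS12 : ~~ same_block (sum_blocks W W') (inl (p false false)) (inl (p true false)) ->
    ~~ same_block (sum_blocks W W') (inr (q false false)) (inr (q true false)) ->
    cover S1 = u :|: u' /\ cover S2 = v :|: v'.
  rewrite !sbE /= => np nq.
  have npp : ~~ crel a g (p false false) (p true false).
    by apply: contra np; apply: circle_same_block.
  have nqq : ~~ crel a' g' (q false false) (q true false).
    by apply: contra nq; apply: circle_same_block.
  have Ip (b i i' : bool) : i == b -> crel a g (p i false) (p i' false) -> i' == b.
    by move/eqP->; apply: contraLR; case: b i' => [] [] //=; rewrite rs.
  have Iq (b i i' : bool) : i == b -> crel a' g' (q i false) (q i' false) -> i' == b.
    by move/eqP->; apply: contraLR; case: b i' => [] [] //=; rewrite rs'.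
  split; apply/setP=> z.
    have := touch12 (pred1 false) z (Ip false) (Iq false).
    rewrite !existsb /= orbF cover_set2 !in_setU => <-.
    by case: z => x; rewrite /= existsb !mem_sum !inE /= ?orbF.
  have := touch12 (pred1 true) z (Ip true) (Iq true).
  rewrite !existsb /= cover_set2 !in_setU => <-.
  by case: z => x; rewrite /= existsb !mem_sum !inE /= ?orbF.
have inu (x : T) : (inl x : T + T') \in [set (inl y : T + T') | y in circle a g x].
  by rewrite mem_sum mem_circle.
have inu' (x : T') : (inr x : T + T') \in [set (inr y : T + T') | y in circle a' g' x].
  by rewrite mem_sum mem_circle.
have nsb x y : ~~ same_block (sum_blocks W W') (inl x) (inr y) by rewrite sbE.
have [pR sR] := glue_spec (sum_sets_partition pX pX') (circles_partition FK GK)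
  (sum_blocks_partition pX pW pW') (inX _) (inX _) (inX' _) (inX' _)
  (inu _) (inu _) (inu' _) (inu' _) sXY (sS _ _) (sS _ _) (S2n _ _) (S2n _ _)
  (nsb _ _) (nsb _ _) (nsb _ _) (nsb _ _) cS cS12.
split=> // x y; rewrite sR; apply: eq_join_rel; apply: eq_join_rel; exact: sbE.
Qed.

End CircleGlue.

(** * The 2-sum and the operations *)

Lemma same_block_equiv (T : finType) (X : {set {set T}}) W :
  partition X setT -> partition W X -> equiv_rel (same_block W).
Proof.
by move=> pX pW; split; [exact: same_block_refl pX pW | exact: same_block_sym
  | exact: same_block_trans pX pW].
Qed.

(** Moves the join made by an operation at another edge past the two joins of the 2-sum. *)
Lemma join_rel_rot (T : eqType) w (r : rel T) x y a b c d : equiv_rel r ->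
  join_rel w (join_rel true (join_rel true r a b) c d) x y =2
  join_rel true (join_rel true (join_rel w r x y) a b) c d.
Proof.
move=> er s t; rewrite (join_relC true w _ _ _ _ (join_rel_equiv true a b er)).
by apply: eq_join_rel; apply: join_relC.
Qed.

Definition repack (A : arrow_pres) (E : {set label A}) (c : {ffun point A -> point A})
    (v b : {set {set {set point A}}}) : packaged :=
  @Packaged (@ArrowPres (point A) (label A) E (tip A) c (gap_end A)) v b.

(* An equation between packaged presentations cannot be rewritten under a     *)
(* function into [label P]; equations between their components can.           *)
Lemma packaged_components (A : arrow_pres) (E1 E2 : {set label A})
    (c1 c2 : {ffun point A -> point A}) (v1 v2 b1 b2 : {set {set {set point A}}}) :
    packaged_axioms (repack E1 c1 v1 b1) -> packaged_axioms (repack E2 c2 v2 b2) ->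
    E1 = E2 -> c1 = c2 -> same_block v1 =2 same_block v2 -> same_block b1 =2 same_block b2 ->
  [/\ E1 = E2, c1 = c2, v1 = v2 & b1 = b2].
Proof.
move=> h1 h2 EE cc; rewrite -EE -cc in h2 *; case: h1 h2 => /= [hA pv1 pb1] [/= _ pv2 pb2] sv sb.
split=> //; first exact: same_block_eq (vertices_partition hA) pv1 pv2 sv.
exact: same_block_eq (boundaries_partition hA) pb1 pb2 sb.
Qed.

Lemma eq_repack (A : arrow_pres) (E1 E2 : {set label A})
    (c1 c2 : {ffun point A -> point A}) (v1 v2 b1 b2 : {set {set {set point A}}}) :
  [/\ E1 = E2, c1 = c2, v1 = v2 & b1 = b2] -> repack E1 c1 v1 b1 = repack E2 c2 v2 b2.
Proof. by case=> -> -> -> ->. Qed.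

(** Componentwise form of [op_packC], for use where the presentation also occurs in the type of a
    labelling. *)
Lemma op_pack_components o o' (P : packaged) (e f : label P) :
    packaged_axioms P -> e \in edges P -> f \in edges P -> e != f ->
  let P1 := @op_pack o' (op_pack o e) f in let P2 := @op_pack o (op_pack o' f) e in
  [/\ edges P1 = edges P2, arc_end P1 = arc_end P2, vpart P1 = vpart P2
    & bpart P1 = bpart P2].
Proof.
move=> hP eE fE ef; have hA := pres_axioms hP.
have [hPe ve be] := op_spec o hP eE; have [hPf vf bf] := op_spec o' hP fE.
have fE' : f \in edges (op_pack o e) by rewrite !inE eq_sym ef.
have eE' : e \in edges (op_pack o' f) by rewrite !inE ef.
have [hPef vef bef] := op_spec o' hPe fE'; have [hPfe vfe bfe] := op_spec o hPf eE'.
apply: (packaged_components (A := P)) hPef hPfe _ _ _ _.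
- by rewrite /= !setDDl setUC.
- exact: (surgery_comm hA eE fE ef (op_surgery o hP eE) (op_surgery o' hP fE)
    (op_surgery o' hPe fE') (op_surgery o hPf eE')).
- move=> x y; rewrite vef vfe (eq_join_rel _ _ _ ve) (eq_join_rel _ _ _ vf).
  exact/join_relC/(same_block_equiv (vertices_partition hA) (vpartP hP)).
- move=> x y; rewrite bef bfe (eq_join_rel _ _ _ be) (eq_join_rel _ _ _ bf).
  exact/join_relC/(same_block_equiv (boundaries_partition hA) (bpartP hP)).
Qed.

Lemma perm_bool_neg (phi : {perm bool}) i : phi (~~ i) = ~~ phi i.
Proof.
have : phi (~~ i) != phi i by rewrite (inj_eq perm_inj); case: i.
by case: (phi (~~ i)); case: (phi i).
Qed.

Section TwoSumTheory.
Variables (P H : packaged) (f : label P) (e : label H) (phi : {perm bool}).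
Hypotheses (hP : packaged_axioms P) (hH : packaged_axioms H).
Hypotheses (fE : f \in edges P) (eE : e \in edges H).
Let hA := pres_axioms hP.
Let hB := pres_axioms hH.
Local Notation S := (two_sum_pres f e phi).

Lemma is_tip_tip (A : arrow_pres) (l : label A) i h : is_tip l (tip A l i h).
Proof. by apply/is_tipP; exists i, h. Qed.

Lemma is_tip_perm x : is_tip e x -> exists i h, x = tip H e (phi i) h.
Proof. by case/is_tipP=> i [h ->]; exists ((phi^-1)%g i), h; rewrite permKV. Qed.

Lemma sum_arc_tipl i h : arc_end S (inl (tip P f i h)) = inr (tip H e (phi i) h).
Proof.
rewrite ffunE /= !(inj_eq inl_inj) !(tip_eq hA) // eqxx.
by case: i; case: h.
Qed.

Lemma sum_arc_tipr i h : arc_end S (inr (tip H e (phi i) h)) = inl (tip P f i h).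
Proof.
rewrite ffunE /= !(inj_eq inr_inj) !(tip_eq hB) // eqxx !(inj_eq perm_inj).
by case: i; case: h.
Qed.

Lemma sum_arcl x : ~~ is_tip f x -> arc_end S (inl x) = inl (arc_end P x).
Proof.
move=> nx; have nt i h : x == tip P f i h = false.
  by apply: contraNF nx => /eqP->; apply: is_tip_tip.
by rewrite ffunE /= !(inj_eq inl_inj) !nt.
Qed.

Lemma sum_arcr x : ~~ is_tip e x -> arc_end S (inr x) = inr (arc_end H x).
Proof.
move=> nx; have nt i h : x == tip H e i h = false.
  by apply: contraNF nx => /eqP->; apply: is_tip_tip.
by rewrite ffunE /= !(inj_eq inr_inj) !nt.
Qed.

Lemma sum_gapl x : gap_end S (inl x) = inl (gap_end P x).
Proof. by rewrite ffunE. Qed.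

Lemma sum_gapr x : gap_end S (inr x) = inr (gap_end H x).
Proof. by rewrite ffunE. Qed.

Lemma sum_edgel l : (inl l \in edges S) = (l != f) && (l \in edges P).
Proof. by rewrite inE !mem_sum orbF !inE. Qed.

Lemma sum_edger l : (inr l \in edges S) = (l != e) && (l \in edges H).
Proof. by rewrite inE !mem_sum !inE. Qed.

Lemma two_sum_pres_axioms : arrow_pres_axioms S.
Proof.
split.
- case=> x.
    have [/is_tipP[i [h ->]]|nx] := boolP (is_tip f x).
      by rewrite sum_arc_tipl sum_arc_tipr.
    by rewrite !sum_arcl ?(arcK hA) // arc_nontip.
  have [/is_tip_perm[i [h ->]]|nx] := boolP (is_tip e x).
    by rewrite sum_arc_tipr sum_arc_tipl.
  by rewrite !sum_arcr ?(arcK hB) // arc_nontip.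
- by case=> x; rewrite ?sum_gapl ?sum_gapr ?(gapK hA) ?(gapK hB).
- case=> x.
    have [/is_tipP[i [h ->]]|nx] := boolP (is_tip f x).
      by rewrite sum_arc_tipl.
    by rewrite !sum_arcl // (inj_eq inl_inj) (arc_neq hA).
  have [/is_tip_perm[i [h ->]]|nx] := boolP (is_tip e x).
    by rewrite sum_arc_tipr.
  by rewrite !sum_arcr // (inj_eq inr_inj) (arc_neq hB).
- by case=> x; rewrite ?sum_gapl ?sum_gapr ?(inj_eq inl_inj) ?(inj_eq inr_inj)
    ?(gap_neq hA) ?(gap_neq hB).
- move=> [l|l] i h [m|m] j k //; rewrite ?sum_edgel ?sum_edger.
    by move=> /andP[_ lE] /andP[_ mE] [] /(tip_inj hA lE mE)[-> -> ->].
  by move=> /andP[_ lE] /andP[_ mE] [] /(tip_inj hB lE mE)[-> -> ->].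
- move=> [l|l] i h; rewrite ?sum_edgel ?sum_edger => /andP[ln lE].
    by rewrite sum_arcl ?(arc_tip hA) // is_tip_neq // eq_sym.
  by rewrite sum_arcr ?(arc_tip hB) // is_tip_neq // eq_sym.
Qed.
Let hS := two_sum_pres_axioms.

Lemma sum_side_tipl i h : @side S (inl (tip P f i h)) = inr (tip H e (phi i) h).
Proof.
rewrite side_arc ?sum_arc_tipl // => -[l|l].
  rewrite sum_edgel => /andP[lf lE]; apply/is_tipP => -[j [k []]] /eqP.
  by rewrite (tip_eq hA) // eq_sym (negbTE lf).
by rewrite sum_edger => _; apply/is_tipP => -[j [k]].
Qed.

Lemma sum_side_tipr i h : @side S (inr (tip H e (phi i) h)) = inl (tip P f i h).
Proof. by rewrite -sum_side_tipl (sideK hS). Qed.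

Lemma sum_sidel x : ~~ is_tip f x -> @side S (inl x) = inl (@side P x).
Proof.
move=> nx; have [/existsP[l /andP[lE]]|nt] := boolP [exists l in edges P, is_tip l x].
  case/is_tipP=> i [h xE]; have lf : l != f.
    by apply: contraNneq nx => <-; rewrite xE is_tip_tip.
  have lS : inl l \in edges S by rewrite sum_edgel lf.
  by rewrite xE (side_tip hA) // -[inl _]/(tip S (inl l) i h) (side_tip hS).
have nl l : l \in edges P -> ~~ is_tip l x.
  by move=> lE; apply: contra nt => lx; apply/existsP; exists l; rewrite lE.
rewrite !side_arc ?sum_arcl // => -[l|l]; rewrite ?sum_edgel => lE.
  case/andP: lE => _ lE; apply: contra (nl _ lE) => /is_tipP[j [k [->]]]; exact: is_tip_tip.
by apply/is_tipP => -[j [k]].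
Qed.

Lemma sum_sider x : ~~ is_tip e x -> @side S (inr x) = inr (@side H x).
Proof.
move=> nx; have [/existsP[l /andP[lE]]|nt] := boolP [exists l in edges H, is_tip l x].
  case/is_tipP=> i [h xE]; have lf : l != e.
    by apply: contraNneq nx => <-; rewrite xE is_tip_tip.
  have lS : inr l \in edges S by rewrite sum_edger lf.
  by rewrite xE (side_tip hB) // -[inr _]/(tip S (inr l) i h) (side_tip hS).
have nl l : l \in edges H -> ~~ is_tip l x.
  by move=> lE; apply: contra nt => lx; apply/existsP; exists l; rewrite lE.
rewrite !side_arc ?sum_arcr // => -[l|l]; rewrite ?sum_edger => lE.
  by apply/is_tipP => -[j [k]].
case/andP: lE => _ lE; apply: contra (nl _ lE) => /is_tipP[j [k [->]]]; exact: is_tip_tip.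
Qed.

Local Notation P_H := (two_sum f e phi).

Lemma two_sum_vpart :
  partition (vpart P_H) (vertices S) /\
  same_block (vpart P_H) =2
    join_rel true
      (join_rel true (sum_rel (same_block (vpart P)) (same_block (vpart H)))
         (inl (tip P f false false)) (inr (tip H e (phi false) false)))
      (inl (tip P f true false)) (inr (tip H e (phi true) false)).
Proof.
apply: (circle_glue (p := tip P f) (q := fun i => tip H e (phi i))
  (arcK hA) (gapK hA) (arcK hB) (gapK hB) (arcK hS) (gapK hS)
  _ _ sum_arc_tipl sum_arc_tipr _ _ sum_gapl sum_gapr (vpartP hP) (vpartP hH)).
- by move=> i j; rewrite (arc_tip hA).
- by move=> i j; rewrite (arc_tip hB).
- by move=> x nx; apply: sum_arcl; apply/is_tipP => -[i [h /nx]].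
- by move=> x nx; apply: sum_arcr; apply/negP => /is_tip_perm[i [h /nx]].
Qed.

Lemma two_sum_bpart :
  partition (bpart P_H) (boundaries S) /\
  same_block (bpart P_H) =2
    join_rel true
      (join_rel true (sum_rel (same_block (bpart P)) (same_block (bpart H)))
         (inl (tip P f false false)) (inr (tip H e (phi false) false)))
      (inl (tip P f false true)) (inr (tip H e (phi false) true)).
Proof.
apply: (circle_glue (p := fun i j => tip P f j (i (+) j))
  (q := fun i j => tip H e (phi j) (i (+) j))
  (sideK hA) (gapK hA) (sideK hB) (gapK hB) (sideK hS) (gapK hS)
  _ _ _ _ _ _ sum_gapl sum_gapr (bpartP hP) (bpartP hH)).
- by move=> i j; rewrite (side_tip hA) // addbN.
- by move=> i j; rewrite (side_tip hB) // addbN perm_bool_neg.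
- by move=> i j; rewrite sum_side_tipl.
- by move=> i j; rewrite sum_side_tipr.
- move=> x nx; apply: sum_sidel; apply/is_tipP => -[i [h]].
  by have := nx (h (+) i) i; rewrite addbK.
- move=> x nx; apply: sum_sider; apply/negP => /is_tip_perm[i [h]].
  by have := nx (h (+) i) i; rewrite addbK.
Qed.

Lemma two_sum_axioms : packaged_axioms P_H.
Proof.
split; [exact: hS | by case: two_sum_vpart | by case: two_sum_bpart].
Qed.

End TwoSumTheory.

(** * Operations at other edges commute with the 2-sum *)

Section TwoSumOp.
Variables (o : operation) (P H : packaged) (f : label P) (e : label H) (phi : {perm bool}).
Hypotheses (hP : packaged_axioms P) (hH : packaged_axioms H).
Hypotheses (fE : f \in edges P) (eE : e \in edges H).
Let hA := pres_axioms hP.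
Let hB := pres_axioms hH.
Let hS := two_sum_axioms phi hP hH fE eE.

Let vsum : equiv_rel (sum_rel (same_block (vpart P)) (same_block (vpart H))).
Proof.
exact: sum_rel_equiv (same_block_equiv (vertices_partition hA) (vpartP hP))
  (same_block_equiv (vertices_partition hB) (vpartP hH)).
Qed.

Let bsum : equiv_rel (sum_rel (same_block (bpart P)) (same_block (bpart H))).
Proof.
exact: sum_rel_equiv (same_block_equiv (boundaries_partition hA) (bpartP hP))
  (same_block_equiv (boundaries_partition hB) (bpartP hH)).
Qed.

(** The rewirings at [f] and at [g] concern disjoint sets of tips, and on blocks both constructions
    are joins, which commute. *)
Lemma op_two_suml_components (g : label P) : g \in edges P -> g != f ->
  let S1 := @op_pack o (two_sum f e phi) (inl g) in
  let S2 := @two_sum (op_pack o g) H f e phi in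
  [/\ edges S1 = edges S2, arc_end S1 = arc_end S2, vpart S1 = vpart S2
    & bpart S1 = bpart S2].
Proof.
move=> gE gf.
have gS : inl g \in edges (two_sum f e phi) by rewrite sum_edgel gf.
have fE' : f \in edges (op_pack o g) by rewrite !inE eq_sym gf.
have [hg vg bg] := op_spec o hP gE; have [hSg vSg bSg] := op_spec o hS gS.
have hSg' := two_sum_axioms phi hg hH fE' eE.
have [s1 s2] := op_surgery o hP gE; have [S1 S2] := op_surgery o hS gS.
apply: (packaged_components (A := two_sum_pres f e phi)) hSg hSg' _ _ _ _.
- apply/setP=> -[l|l]; rewrite !inE !mem_sum ?inE //=.
    by rewrite orbF (inj_eq inl_inj) orbF; case: (l == g); case: (l == f).
- apply/ffunP=> -[x|x].
    have [/is_tipP[i [h ->]]|xf] := boolP (is_tip f x).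
      rewrite (sum_arc_tipl e phi hg) // S2 ?sum_arc_tipl //.
      apply/is_tipP => -[j [k []]] /eqP; rewrite (tip_eq hA) //.
      by rewrite eq_sym (negbTE gf).
    rewrite (@sum_arcl (op_pack o g)) //.
    have [/is_tipP[i [h ->]]|xg] := boolP (is_tip g x).
      by rewrite s1; apply: S1.
    rewrite s2 // S2 ?sum_arcl //.
  rewrite S2; last by apply/is_tipP => -[j [k]].
  have [/(is_tip_perm phi)[i [h ->]]|xe] := boolP (is_tip e x).
    by rewrite sum_arc_tipr // (@sum_arc_tipr (op_pack o g)).
  by rewrite sum_arcr // (@sum_arcr (op_pack o g)).
- have [_ v0] := two_sum_vpart phi hP hH fE eE.
  have [_ v1] := two_sum_vpart phi hg hH fE' eE.
  move=> x y; rewrite vSg v1 (eq_join_rel _ _ _ v0).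
  rewrite join_rel_rot; last exact: vsum.
  do 2 apply: eq_join_rel => {x y} x y; rewrite -sum_rel_joinl.
  by apply: eq_sum_rel => {x y} x y; rewrite ?vg.
- have [_ v0] := two_sum_bpart phi hP hH fE eE.
  have [_ v1] := two_sum_bpart phi hg hH fE' eE.
  move=> x y; rewrite bSg v1 (eq_join_rel _ _ _ v0).
  rewrite join_rel_rot; last exact: bsum.
  do 2 apply: eq_join_rel => {x y} x y; rewrite -sum_rel_joinl.
  by apply: eq_sum_rel => {x y} x y; rewrite ?bg.
Qed.

Lemma op_two_suml (g : label P) : g \in edges P -> g != f ->
  @op_pack o (two_sum f e phi) (inl g) = @two_sum (op_pack o g) H f e phi.
Proof.
by move=> gE gf; apply: eq_repack (op_two_suml_components gE gf).
Qed.

Lemma op_two_sumr (g : label H) : g \in edges H -> g != e ->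
  @op_pack o (two_sum f e phi) (inr g) = @two_sum P (op_pack o g) f e phi.
Proof.
move=> gE ge.
have gS : inr g \in edges (two_sum f e phi) by rewrite sum_edger ge.
have eE' : e \in edges (op_pack o g) by rewrite !inE eq_sym ge.
have [hg vg bg] := op_spec o hH gE; have [hSg vSg bSg] := op_spec o hS gS.
have hSg' := two_sum_axioms phi hP hg fE eE'.
have [s1 s2] := op_surgery o hH gE; have [S1 S2] := op_surgery o hS gS.
apply: (packaged_ext (A := two_sum_pres f e phi)) hSg hSg' _ _ _ _.
- apply/setP=> -[l|l]; rewrite !inE !mem_sum ?inE //=.
  by rewrite (inj_eq inr_inj); case: (l == g); case: (l == e).
- apply/ffunP=> -[x|x].
    rewrite S2; last by apply/is_tipP => -[j [k]].
    have [/is_tipP[i [h ->]]|xf] := boolP (is_tip f x).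
      by rewrite sum_arc_tipl // (@sum_arc_tipl P (op_pack o g)).
    by rewrite sum_arcl // (@sum_arcl P (op_pack o g)).
  have [/(is_tip_perm phi)[i [h ->]]|xe] := boolP (is_tip e x).
    rewrite (@sum_arc_tipr P (op_pack o g)) // S2 ?sum_arc_tipr //.
    apply/is_tipP => -[j [k []]] /eqP; rewrite (tip_eq hB) //.
    by rewrite eq_sym (negbTE ge).
  rewrite (@sum_arcr P (op_pack o g)) //.
  have [/is_tipP[i [h ->]]|xg] := boolP (is_tip g x).
    by rewrite s1; apply: S1.
  rewrite s2 // S2 ?sum_arcr //.
- have [_ v0] := two_sum_vpart phi hP hH fE eE.
  have [_ v1] := two_sum_vpart phi hP hg fE eE'.
  move=> x y; rewrite vSg v1 (eq_join_rel _ _ _ v0).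
  rewrite join_rel_rot; last exact: vsum.
  do 2 apply: eq_join_rel => {x y} x y; rewrite -sum_rel_joinr.
  by apply: eq_sum_rel => {x y} x y; rewrite ?vg.
- have [_ v0] := two_sum_bpart phi hP hH fE eE.
  have [_ v1] := two_sum_bpart phi hP hg fE eE'.
  move=> x y; rewrite bSg v1 (eq_join_rel _ _ _ v0).
  rewrite join_rel_rot; last exact: bsum.
  do 2 apply: eq_join_rel => {x y} x y; rewrite -sum_rel_joinr.
  by apply: eq_sum_rel => {x y} x y; rewrite ?bg.
Qed.

End TwoSumOp.

(** * Counting circles and blocks *)

Section CountMatched.
Variables (T T' : finType) (r : rel T) (r' : rel T').
Variables (p : bool -> bool -> T) (q : bool -> bool -> T') (k l : bool * bool).
Hypotheses (er : equiv_rel r) (er' : equiv_rel r').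
Hypotheses (mp : matched k r p) (mq : matched l r' q) (k0 : k.1 || k.2) (l0 : l.1 || l.2).

(** For nonzero [j], the two pairs of tips exchanged by the translation by [j], in one formula for
    the three cases. *)
Definition rejoin (j : bool * bool) :=
  join_rel true (join_rel true r (p false false) (p j.1 j.2))
    (p (~~ j.1) j.1) (p true (j.2 (+) j.1)).

(** Rejoining along the pairing of the strands closes each strand by itself; any other pairing puts
    both strands on one circle. *)
Lemma nclass_rejoin j : j.1 || j.2 -> nclass r + (j == k) = (nclass (rejoin j)).+1.
Proof.
move=> j0; rewrite (nclass_join (p false false) (p j.1 j.2) er).
rewrite (nclass_join (p (~~ j.1) j.1) (p true (j.2 (+) j.1)) (join_rel_equiv _ _ _ er)).
rewrite -/(rejoin j) /join_rel /= !mp.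
move: (nclass _) => N; case: j k j0 k0 => [[] []] [[] []] //= _ _;
by rewrite ?addn0 ?addn1.
Qed.

Lemma nclass_matched : exists n, nclass r = n.+2.
Proof.
(* A pairing different from [k]: this formula permutes the three nonzero vectors cyclically.
   Rejoining along it loses one class and leaves at least one. *)
have : nclass r + ((k.2, ~~ (k.1 && k.2)) == k) = (nclass (rejoin (k.2, ~~ (k.1 && k.2)))).+1.
  by apply: nclass_rejoin; case: k k0 => [[] []].
have := nclass_gt0 (rejoin (k.2, ~~ (k.1 && k.2))) (p false false).
case: (nclass (rejoin _)) => // n _.
have -> : ((k.2, ~~ (k.1 && k.2)) == k) = false by case: k k0 => [[] []].
by rewrite addn0; exists n.
Qed.

Definition weld :=
  join_rel true (join_rel true (join_rel true (join_rel true (sum_rel r r')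
    (inl (p false false)) (inr (q false false)))
    (inl (p false true)) (inr (q false true)))
    (inl (p true false)) (inr (q true false)))
    (inl (p true true)) (inr (q true true)).

(** The four strands, two from each side, form two circles if the pairings agree and a single one
    otherwise. *)
Lemma nclass_weld : nclass r + nclass r' + (k == l) = nclass weld + 3.
Proof.
have es := sum_rel_equiv er er'.
rewrite -(nclass_sum r' er) (nclass_join (inl (p false false)) (inr (q false false)) es).
have e1 := join_rel_equiv true (inl (p false false)) (inr (q false false)) es.
rewrite (nclass_join (inl (p false true)) (inr (q false true)) e1).
have e2 := join_rel_equiv true (inl (p false true)) (inr (q false true)) e1.
rewrite (nclass_join (inl (p true false)) (inr (q true false)) e2).
have e3 := join_rel_equiv true (inl (p true false)) (inr (q true false)) e2.
rewrite (nclass_join (inl (p true true)) (inr (q true true)) e3).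
rewrite -/weld; move: (nclass weld) => N; rewrite /join_rel /= !mp !mq.
case: k l k0 l0 => [[] []] [[] []] //= _ _; rewrite ?addn0 -?addnA //.
Qed.

End CountMatched.

(** A permutation of the booleans is a translation, and a pairing depends only on differences of
    indices. Hence the choice of coupling does not affect the count. *)
Lemma matched_perm (T : eqType) k (r : rel T) (q : bool -> bool -> T) (phi : {perm bool}) :
  matched k r q -> matched k r (fun i => q (phi i)).
Proof.
move=> mq i h i' h'; rewrite mq; suff -> : phi i (+) phi i' = i (+) i' by [].
have pt : phi true = ~~ phi false := perm_bool_neg phi false.
by case: i i' => [] []; rewrite ?pt; case: (phi false).
Qed.

(** * Strands between the tips of an edge *)

Section CutTips.
Variables (A : arrow_pres) (e : label A).
Hypotheses (hA : arrow_pres_axioms A) (eE : e \in edges A).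
Local Notation tp := (tip A e).

Definition strand := crel (cut (is_tip e) (arc_end A)) (gap_end A).

Lemma is_tip_arc x : is_tip e (arc_end A x) = is_tip e x.
Proof.
apply/idP/idP; apply: contraTT; first exact: arc_nontip.
by move/(arc_nontip hA eE); rewrite (arcK hA).
Qed.

Lemma cut_arcK : involutive (cut (is_tip e) (arc_end A)).
Proof. apply: cutK; [exact: arcK | exact: is_tip_arc]. Qed.

Lemma strand_equiv : equiv_rel strand.
Proof. apply: crel_equiv; [exact: cut_arcK | exact: gapK]. Qed.

Lemma strand_matched : exists2 k, k.1 || k.2 & matched k strand tp.
Proof.
apply: matching; [exact: cut_arcK | exact: gapK | exact: gap_neq | |].
  move=> x; split=> [/eqP|/is_tipP xt].
    by rewrite cut_fix => [/is_tipP|y]; rewrite ?(arc_neq hA).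
  by apply/eqP; rewrite cut_fix // => y; rewrite (arc_neq hA).
by move=> i h j k /(tip_inj hA eE eE)[_].
Qed.

(** Surgery puts two new arcs in place of the missing ones, so its circles are the strands closed
    along the pairing [k]. *)
Lemma surgery_rejoin k c : k.1 || k.2 -> surgery k e c ->
  crel c (gap_end A) =2 rejoin strand tp k.
Proof.
move=> k0 [ct cn]; have cK : involutive c by apply: (arcK (surgery_axioms hA eE k0 (conj ct cn))).
have er := join_rel_equiv true (tp (~~ k.1) k.1) (tp true (k.2 (+) k.1))
  (join_rel_equiv true (tp false false) (tp k.1 k.2) strand_equiv).
have ec := crel_equiv cK (gapK hA).
have sub x y : strand x y -> rejoin strand tp k x y by move=> xy; do 2 apply: join_rel_sub.
have [rr rs _] := er; have es := strand_equiv.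
move=> x y; apply/idP/idP; last first.
  apply: join_rel_min => // [|_]; last first.
    by have := crel1 c (gap_end A) (tp (~~ k.1) k.1); rewrite ct; case: (k.1) (k.2) => [] [].
  apply: join_rel_min => // [|_]; last first.
    by have := crel1 c (gap_end A) (tp false false); rewrite ct !addbF.
  apply: crel_min => // z; last exact: crel2.
  by rewrite /cut; case: ifP => [_|/negbT/cn<-]; [exact: connect0 | exact: crel1].
apply: crel_min => // z; last exact/sub/crel2.
have [/is_tipP[i [h ->]]|nz] := boolP (is_tip e z); last first.
  by rewrite cn //; apply: sub; have := crel1 (cut (is_tip e) (arc_end A)) (gap_end A) z;
     rewrite /cut (negbTE nz).
have j1 : rejoin strand tp k (tp false false) (tp k.1 k.2).
  by apply: join_rel_sub; apply: join_rel_pq.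
have j2 : rejoin strand tp k (tp (~~ k.1) k.1) (tp true (k.2 (+) k.1)).
  by apply: join_rel_pq => //; apply: join_rel_equiv.
have j1' := etrans (rs _ _) j1; have j2' := etrans (rs _ _) j2.
rewrite ct; move: k0 j1 j2 j1' j2'; rewrite -/(rejoin strand tp k).
by case: (k) => [[] []] //= _; case: i; case: h.
Qed.

End CutTips.

Section WeldTips.
Variables (P H : packaged) (f : label P) (e : label H) (phi : {perm bool}).
Hypotheses (hP : packaged_axioms P) (hH : packaged_axioms H).
Hypotheses (fE : f \in edges P) (eE : e \in edges H).
Let hA := pres_axioms hP.
Let hB := pres_axioms hH.
Local Notation S := (two_sum_pres f e phi).
Local Notation q := (fun i => tip H e (phi i)).

Lemma two_sum_weld : crel (arc_end S) (gap_end S) =2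
  weld (strand f) (strand e) (tip P f) q.
Proof.
have hS := two_sum_pres_axioms phi hP hH fE eE.
have e0 := sum_rel_equiv (strand_equiv hA fE) (strand_equiv hB eE).
have e1 := join_rel_equiv true (inl (tip P f false false)) (inr (q false false)) e0.
have e2 := join_rel_equiv true (inl (tip P f false true)) (inr (q false true)) e1.
have e3 := join_rel_equiv true (inl (tip P f true false)) (inr (q true false)) e2.
have e4 := join_rel_equiv true (inl (tip P f true true)) (inr (q true true)) e3.
have ec := crel_equiv (arcK hS) (gapK hS).
have sub x y : sum_rel (strand f) (strand e) x y -> weld (strand f) (strand e) (tip P f) q x y.
  by move=> xy; do 4 apply: join_rel_sub.
have [rr rs _] := e4.
have tips i h : weld (strand f) (strand e) (tip P f) q (inl (tip P f i h)) (inr (q i h)).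
  case: i; case: h; [|apply: join_rel_sub|do 2 apply: join_rel_sub|do 3 apply: join_rel_sub];
  exact: join_rel_pq.
have jn i h : crel (arc_end S) (gap_end S) (inl (tip P f i h)) (inr (q i h)).
  by rewrite -(sum_arc_tipl e phi hP fE); apply: crel1.
move=> x y; apply/idP/idP; last first.
  do 4 (apply: (join_rel_min ec _ (fun _ => jn _ _))).
  case=> s [t|t] //.
    apply: (crel_ind (Z := fun t => crel (arc_end S) (gap_end S) (inl s) (inl t))) => [z sz|z sz|];
      last exact: connect0.
      rewrite /cut; case: ifP => [//|/negbT nz]; apply: connect_trans sz _.
      by rewrite -(sum_arcl e phi nz) crel1.
    by apply: connect_trans sz _; rewrite -(sum_gapl f e phi) crel2.
  apply: (crel_ind (Z := fun t => crel (arc_end S) (gap_end S) (inr s) (inr t))) => [z sz|z sz|];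
    last exact: connect0.
    rewrite /cut; case: ifP => [//|/negbT nz]; apply: connect_trans sz _.
    by rewrite -(sum_arcr f phi nz) crel1.
  by apply: connect_trans sz _; rewrite -(sum_gapr f e phi) crel2.
apply: crel_min => // -[z|z]; rewrite ?sum_gapl ?sum_gapr; try exact/sub/crel2.
  have [/is_tipP[i [h ->]]|nz] := boolP (is_tip f z).
    by rewrite sum_arc_tipl.
  rewrite sum_arcl //; apply: sub => /=.
  by have := crel1 (cut (is_tip f) (arc_end P)) (gap_end P) z; rewrite {2}/cut (negbTE nz).
have [/(is_tip_perm phi)[i [h ->]]|nz] := boolP (is_tip e z).
  by rewrite sum_arc_tipr //; exact: etrans (rs _ _) (tips i h).
rewrite sum_arcr //; apply: sub => /=.
by have := crel1 (cut (is_tip e) (arc_end H)) (gap_end H) z; rewrite {2}/cut (negbTE nz).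
Qed.

End WeldTips.

(* A presentation whose only edge is [e] is, for the other constructions, the *)
(* same as a scalar times one of the five results of removing an edge: [t]    *)
(* tells which, and [n], [m] and [l] are the exponents of the scalar.         *)
Record one_edge (P : packaged) (e : label P) (t : operation) (n m l : nat) : Prop := OneEdge {
  one_matched : matched (op_kind t) (strand e) (tip P e);
  one_strand : nclass (strand e) = n.+2;
  one_sbv : same_block (vpart P) (tip P e false false) (tip P e true false) = joins_v t;
  one_sbb : same_block (bpart P) (tip P e false false) (tip P e false true) = joins_b t;
  one_vpart : #|vpart P| = m + 1 + ~~ joins_v t;
  one_bpart : #|bpart P| = l + 1 + ~~ joins_b t }.

Section OneEdgeTheory.
Variables (P : packaged) (e : label P).
Hypotheses (hP : packaged_axioms P) (eE : edges P = [set e]).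
Let hA := pres_axioms hP.

Let eP : e \in edges P. Proof. by rewrite eE set11. Qed.

Lemma strand_sub_vertex x y : strand e x y -> same_block (vpart P) x y.
Proof.
move=> xy; apply: (circle_same_block (arcK hA) (gapK hA) (vpartP hP)).
apply: crel_ind xy => [z xz|z xz|]; last exact: connect0.
  by rewrite /cut; case: ifP => // _; apply: connect_trans xz (crel1 _ _ _).
exact: connect_trans xz (crel2 _ _ _).
Qed.

(** As [e] is the only edge, boundary curves follow the arcs away from its tips; so a strand is a
    piece of a boundary component as well as of a vertex. *)
Lemma strand_sub_boundary x y : strand e x y -> same_block (bpart P) x y.
Proof.
move=> xy; apply: (circle_same_block (sideK hA) (gapK hA) (bpartP hP)).
apply: crel_ind xy => [z xz|z xz|]; last exact: connect0.
  rewrite /cut; case: ifP => // /negbT nz; apply: connect_trans xz _.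
  rewrite -(side_arc (x := z)) ?crel1 // => l; by rewrite eE inE => /eqP->.
exact: connect_trans xz (crel2 _ _ _).
Qed.

Lemma nclass_same (X : {set {set point P}}) W x y :
  partition X setT -> partition W X -> exists m, #|W| = m + 1 + ~~ same_block W x y.
Proof.
move=> pX pW; rewrite (nclass_part pX pW) (nclass_join x y (same_block_equiv pX pW)).
have := nclass_gt0 (join_rel true (same_block W) x y) x.
by case: nclass => // n _; exists n; rewrite addn1.
Qed.

(** The pairing forces part of the block data: in the contraction pattern both arrows lie on one
    vertex, in the deletion pattern there is one boundary component, in the Penrose pattern both
    hold. The coincidence left open in the first two patterns tells [Con] from [ConM] and [Del] from
    [DelM]. *)
Lemma one_edgeP : exists t n m l, one_edge e t n m l.
Proof.
have [k k0 mk] := strand_matched hA eP; have er := strand_equiv hA eP.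
have [n nE] := nclass_matched er mk k0.
have pV := vertices_partition hA; have pB := boundaries_partition hA.
set p := tip P e in mk.
have [m mE] := nclass_same (p false false) (p true false) pV (vpartP hP).
have [l lE] := nclass_same (p false false) (p false true) pB (bpartP hP).
have [_ vs vt] := same_block_equiv pV (vpartP hP).
have [_ bs bt] := same_block_equiv pB (bpartP hP).
have varc x : same_block (vpart P) x (arc_end P x).
  exact/(circle_same_block (arcK hA) (gapK hA) (vpartP hP))/crel1.
have bside x : same_block (bpart P) x (@side P x).
  exact/(circle_same_block (sideK hA) (gapK hA) (bpartP hP))/crel1.
suff [t [tk tv tb]] : exists t, [/\ op_kind t = k,
    same_block (vpart P) (p false false) (p true false) = joins_v t
  & same_block (bpart P) (p false false) (p false true) = joins_b t].
  by exists t, n, m, l; split=> //; rewrite ?tk // -?tv -?tb.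
case: k k0 mk => [[] []] //= _ mk.
- have v : same_block (vpart P) (p false false) (p true false).
    have s : strand e (p false false) (p true true) by rewrite mk.
    apply: vt (strand_sub_vertex s) _.
    by have := varc (p true true); rewrite (arc_tip hA).
  by rewrite v; case: (same_block (bpart P) _ _); [exists ConM | exists Con].
- have s : strand e (p false false) (p true false) by rewrite mk.
  have b : same_block (bpart P) (p false false) (p false true).
    apply: bt (strand_sub_boundary s) _.
    by have := bside (p true false); rewrite (side_tip hA).
  by exists Pen; rewrite (strand_sub_vertex s) b.
- have s : strand e (p false false) (p false true) by rewrite mk.
  rewrite (strand_sub_boundary s).
  by case: (same_block (vpart P) _ _); [exists DelM | exists Del].
Qed.

Lemma edges_op o : edges (op_pack o e) = set0.
Proof. by rewrite /= eE setDv. Qed.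

Variables (t : operation) (n m l : nat).
Hypothesis one : one_edge e t n m l.

Lemma op_vertices o : #|vertices (op_pack o e)| = n + 1 + (op_kind o == op_kind t).
Proof.
have := nclass_rejoin (strand_equiv hA eP) (one_matched one) (op_kind_neq0 t) (op_kind_neq0 o).
rewrite (one_strand one) [vertices _]/= /vertices card_circles.
rewrite (eq_nclass (surgery_rejoin hA eP (op_kind_neq0 o) (op_surgery o hP eP))).
by rewrite !addSn addn1 addSn => -[].
Qed.

Lemma op_vpart_card o : #|vpart (op_pack o e)| = m + 1 + (~~ joins_v o && ~~ joins_v t).
Proof.
have [[hA' pV' _] sV _] := op_spec o hP eP.
rewrite (nclass_part (vertices_partition hA') pV') (eq_nclass sV).
have pV := vertices_partition hA; have er := same_block_equiv pV (vpartP hP).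
have := one_vpart one; rewrite (nclass_part pV (vpartP hP)).
case: (joins_v o) => /=; last by move=> <-; apply: eq_nclass => x y; rewrite /join_rel orbF.
rewrite (nclass_join (tip P e false false) (tip P e true false) er) (one_sbv one).
by rewrite addn0 => /addIn.
Qed.

Lemma op_bpart_card o : #|bpart (op_pack o e)| = l + 1 + (~~ joins_b o && ~~ joins_b t).
Proof.
have [[hA' _ pB'] _ sB] := op_spec o hP eP.
rewrite (nclass_part (boundaries_partition hA') pB') (eq_nclass sB).
have pB := boundaries_partition hA; have er := same_block_equiv pB (bpartP hP).
have := one_bpart one; rewrite (nclass_part pB (bpartP hP)).
case: (joins_b o) => /=; last by move=> <-; apply: eq_nclass => x y; rewrite /join_rel orbF.
rewrite (nclass_join (tip P e false false) (tip P e false true) er) (one_sbb one).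
by rewrite addn0 => /addIn.
Qed.

End OneEdgeTheory.

(** * 2-sums of two presentations with one edge each *)

Section OneEdgeSum.
Variables (P H : packaged) (f : label P) (e : label H) (phi : {perm bool}).
Hypotheses (hP : packaged_axioms P) (hH : packaged_axioms H).
Hypotheses (fE : edges P = [set f]) (eE : edges H = [set e]).
Variables (o t : operation) (n m l n' m' l' : nat).
Hypotheses (one : one_edge f o n m l) (one' : one_edge e t n' m' l').
Let hA := pres_axioms hP.
Let hB := pres_axioms hH.
Let fP : f \in edges P. Proof. by rewrite fE set11. Qed.
Let eP : e \in edges H. Proof. by rewrite eE set11. Qed.

Lemma edges_sum : edges (two_sum f e phi) = set0.
Proof. by rewrite /= fE eE !setDv !imset0 setU0. Qed.

Lemma sum_vertices :
  #|vertices (two_sum f e phi)| = n + n' + (1 + (op_kind o == op_kind t)).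
Proof.
have := nclass_weld (strand_equiv hA fP) (strand_equiv hB eP) (one_matched one)
  (matched_perm phi (one_matched one')) (op_kind_neq0 o) (op_kind_neq0 t).
rewrite -(eq_nclass (@two_sum_weld P H f e phi hP hH fP eP)) (one_strand one) (one_strand one').
rewrite -[nclass _]/#|vertices (two_sum f e phi)|.
by move: #|vertices _| (op_kind o == op_kind t) => N b; lia.
Qed.

(** The first join links different sides and always merges two classes; the second does so unless
    connections on both sides already close a cycle. *)
Lemma nclass_joins (T T' : finType) (r : rel T) (r' : rel T') x x' y y' :
    equiv_rel r -> equiv_rel r' ->
  nclass r + nclass r' =
    nclass (join_rel true (join_rel true (sum_rel r r') (inl x) (inr y)) (inl x') (inr y'))
    + 1 + ~~ (r x x' && r' y y').
Proof.
move=> er er'; have [_ rs _] := er; have [_ rs' _] := er'; have es := sum_rel_equiv er er'.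
rewrite -(nclass_sum r' er) (nclass_join (inl x) (inr y) es).
rewrite (nclass_join (inl x') (inr y') (join_rel_equiv true (inl x) (inr y) es)).
rewrite addnAC; congr (_ + ~~ _); rewrite {1}/join_rel /= orbF.
by rewrite rs rs'.
Qed.

Lemma sum_vpart_card :
  #|vpart (two_sum f e phi)| = m + m' + (1 + (~~ joins_v o && ~~ joins_v t)).
Proof.
have [pV sV] := two_sum_vpart phi hP hH fP eP.
have pA := vertices_partition hA; have pB := vertices_partition hB.
rewrite (nclass_part (vertices_partition (two_sum_pres_axioms phi hP hH fP eP)) pV).
rewrite (eq_nclass sV).
have := nclass_joins (tip P f false false) (tip P f true false)
  (tip H e (phi false) false) (tip H e (phi true) false)
  (same_block_equiv pA (vpartP hP)) (same_block_equiv pB (vpartP hH)).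
have -> : same_block (vpart H) (tip H e (phi false) false) (tip H e (phi true) false) = joins_v t.
  rewrite -(one_sbv one') -[true]/(~~ false) perm_bool_neg.
  by case: (phi false) => //; apply: same_block_sym.
rewrite (one_sbv one) -(nclass_part pA (vpartP hP)) -(nclass_part pB (vpartP hH)).
rewrite (one_vpart one) (one_vpart one') => E.
by move: E; set N := nclass _; case: (joins_v o); case: (joins_v t) => /=; lia.
Qed.

Lemma sum_bpart_card :
  #|bpart (two_sum f e phi)| = l + l' + (1 + (~~ joins_b o && ~~ joins_b t)).
Proof.
have [pV sV] := two_sum_bpart phi hP hH fP eP.
have pA := boundaries_partition hA; have pB := boundaries_partition hB.
rewrite (nclass_part (boundaries_partition (two_sum_pres_axioms phi hP hH fP eP)) pV).
rewrite (eq_nclass sV).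
have := nclass_joins (tip P f false false) (tip P f false true)
  (tip H e (phi false) false) (tip H e (phi false) true)
  (same_block_equiv pA (bpartP hP)) (same_block_equiv pB (bpartP hH)).
have -> : same_block (bpart H) (tip H e (phi false) false) (tip H e (phi false) true) = joins_b t.
  (* When the coupling swaps the arrows, the ends of the other arrow lie on the same two boundary
     components in the opposite order. *)
  rewrite -(one_sbb one'); case: (phi false) => //.
  have [_ bs _] := same_block_equiv pB (bpartP hH).
  have bside x : same_block (bpart H) x (@side H x).
    exact/(circle_same_block (sideK hB) (gapK hB) (bpartP hH))/crel1.
  have := bside (tip H e true false); have := bside (tip H e true true).
  rewrite !(side_tip hB) //= => b1 b2.
  rewrite (equiv_congr _ (same_block_equiv pB (bpartP hH)) b2) bs.
  by rewrite (equiv_congr _ (same_block_equiv pB (bpartP hH)) b1).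
rewrite (one_sbb one) -(nclass_part pA (bpartP hP)) -(nclass_part pB (bpartP hH)).
rewrite (one_bpart one) (one_bpart one') => E.
by move: E; set N := nclass _; case: (joins_b o); case: (joins_b t) => /=; lia.
Qed.

End OneEdgeSum.

(** * The polynomial of a 2-sum *)

Local Open Scope ring_scope.

Section Combination.
Variable K : comNzRingType.
Implicit Types (w G : operation -> K).

Definition lincomb w G :=
  w Del * G Del + w Con * G Con + w Pen * G Pen + w DelM * G DelM + w ConM * G ConM.

Lemma eq_lincomb w G (G' : operation -> K) : G =1 G' -> lincomb w G = lincomb w G'.
Proof. by move=> GG'; rewrite /lincomb !GG'. Qed.

Lemma lincombC w (w' : operation -> K) (G : operation -> operation -> K) :
  lincomb w (fun o => lincomb w' (G o)) = lincomb w' (fun o' => lincomb w (G^~ o')).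
Proof. by rewrite /lincomb; ring. Qed.

Lemma lincombA w (F : operation -> operation -> K) G :
  lincomb w (fun o => lincomb (F o) G) = lincomb (fun t => lincomb w (F^~ t)) G.
Proof. by rewrite /lincomb; ring. Qed.

Definition single (t : operation) (d : K) (o : operation) : K :=
  match t, o with
  | Del, Del | Con, Con | Pen, Pen | DelM, DelM | ConM, ConM => d
  | _, _ => 0
  end.

Lemma lincomb_single t d G : lincomb (single t d) G = d * G t.
Proof. by case: t; rewrite /lincomb /=; ring. Qed.

End Combination.

Lemma operation_choice (T : Type) (R : operation -> T -> Prop) :
  (forall o, exists F, R o F) -> exists F, forall o, R o (F o).
Proof.
move=> ex; have [F1 h1] := ex Del; have [F2 h2] := ex Con; have [F3 h3] := ex Pen.
have [F4 h4] := ex DelM; have [F5 h5] := ex ConM.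
by exists (fun o => match o with Del => F1 | Con => F2 | Pen => F3 | DelM => F4
  | ConM => F5 end); case.
Qed.

Section TensorPolynomial.
Variables (K : comNzRingType) (alpha beta gamma : K).

Definition Qw (w : operation -> K) :=
  Q_poly (w Del) (w Con) (w Pen) (w DelM) (w ConM) alpha beta gamma.

Lemma Qw_rec w (P : packaged) (e : label P) : packaged_axioms P -> e \in edges P ->
  Qw w P = lincomb w (fun o => Qw w (op_pack o e)).
Proof. by move=> hP eP; apply: Q_rec. Qed.

Lemma Qw_edgeless w (P : packaged) : edges P = set0 ->
  Qw w P = alpha ^+ #|vertices P| * beta ^+ #|vpart P| * gamma ^+ #|bpart P|.
Proof. exact: Q_edgeless. Qed.

(** The entry of the system at [(o, t)]. It is symmetric, which lets [o] stand for an operation or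
    for the state of the other summand. *)
Definition pairing (o t : operation) : K :=
  alpha ^+ (1 + (op_kind o == op_kind t))
  * beta ^+ (1 + (~~ joins_v o && ~~ joins_v t))
  * gamma ^+ (1 + (~~ joins_b o && ~~ joins_b t)).

Section Coefficients.
Variable w : operation -> K.
Local Notation Q := (Qw w).

(** The first condition is the linear system; the second says that a copy of [H] at an edge acts
    like a five-term recursion there with coefficients [F]. *)
Definition edge_coef (H : packaged) (e : label H) (F : operation -> K) : Prop :=
  (forall o, Q (op_pack o e) = lincomb F (pairing o)) /\
  (forall (P : packaged) (f : label P) phi, packaged_axioms P -> f \in edges P ->
     Q (two_sum f e phi) = lincomb F (fun o => Q (op_pack o f))).

(** Up to a monomial, [H] acts as its state [t]. Expanding [P] at the edges other than [f] reduces
    the second condition to a [P] with one edge, where the exponents on both sides agree. *)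
Lemma edge_coef_one (H : packaged) (e : label H) :
  packaged_axioms H -> edges H = [set e] -> exists F, edge_coef e F.
Proof.
move=> hH eE; have eH : e \in edges H by rewrite eE set11.
have [t [n [m [l one]]]] := one_edgeP hH eE.
exists (single t (alpha ^+ n * beta ^+ m * gamma ^+ l)); split=> [o|P f phi].
  rewrite lincomb_single Qw_edgeless ?edges_op // (op_vertices hH eE one).
  rewrite (op_vpart_card hH eE one) (op_bpart_card hH eE one) /pairing -!addnA.
  by rewrite ![_ ^+ (_ + (1 + _))]exprD; ring.
have [k] := ubnP #|edges P|; elim: k => // k IHk in P f *.
rewrite ltnS => leEk hP fP.
have hS := two_sum_axioms phi hP hH fP eH.
have [E0|[g]] := set_0Vmem (edges P :\ f); last first.
  rewrite !inE => /andP[gf gP].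
  have gS : inl g \in edges (two_sum f e phi) by rewrite sum_edgel gf.
  rewrite (Qw_rec w hS gS); transitivity (lincomb w (fun o =>
      lincomb (single t (alpha ^+ n * beta ^+ m * gamma ^+ l))
        (fun o' => Q (@op_pack o' (op_pack o g) f)))).
    apply: eq_lincomb => o; rewrite op_two_suml //.
    have [hg _ _] := op_spec o hP gP.
    apply: IHk => //; last by rewrite !inE eq_sym gf.
    by apply: leq_trans leEk; rewrite (cardsD1 g (edges P)) gP.
  rewrite lincombC; apply: eq_lincomb => o'.
  have [hf _ _] := op_spec o' hP fP.
  have gf' : g \in edges (op_pack o' f) by rewrite !inE gf.
  rewrite (Qw_rec w hf gf'); apply: eq_lincomb => o.
  by rewrite op_packC.
have fE : edges P = [set f] by rewrite -(setD1K fP) E0 setU0.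
have [o [n' [m' [l' one']]]] := one_edgeP hP fE.
rewrite lincomb_single Qw_edgeless; last exact: edges_sum.
rewrite (sum_vertices phi hP hH fE eE one' one) (sum_vpart_card phi hP hH fE eE one' one).
rewrite (sum_bpart_card phi hP hH fE eE one' one).
rewrite Qw_edgeless ?edges_op // (op_vertices hP fE one').
rewrite (op_vpart_card hP fE one') (op_bpart_card hP fE one') -!addnA.
rewrite (eq_sym (op_kind t)) (andbC (~~ joins_v t)) (andbC (~~ joins_b t)).
by rewrite ![_ ^+ (_ + (_ + (1 + _)))]exprD ![_ ^+ (_ + (1 + _))]exprD; ring.
Qed.

(** Expanding [H] at an edge [g] other than [e] commutes with operations at [e] and with the 2-sum,
    and both conditions are linear. So the coefficients of [H] are the [w]-combination of those of
    the five results at [g]. *)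
Lemma edge_coefP (H : packaged) (e : label H) :
  packaged_axioms H -> e \in edges H -> exists F, edge_coef e F.
Proof.
have [k] := ubnP #|edges H|; elim: k => // k IHk in H e *.
rewrite ltnS => leEk hH eH.
have [E0|[g]] := set_0Vmem (edges H :\ e).
  by apply: edge_coef_one => //; rewrite -(setD1K eH) E0 setU0.
rewrite !inE => /andP[ge gH].
have [F FP] : exists F, forall o, @edge_coef (op_pack o g) e (F o).
  apply: (operation_choice (R := fun o F => @edge_coef (op_pack o g) e F)) => o.
  have [hg _ _] := op_spec o hH gH.
  apply: IHk => //; last by rewrite !inE eq_sym ge.
  by apply: leq_trans leEk; rewrite (cardsD1 g (edges H)) gH.
exists (fun t => lincomb w (F^~ t)); split=> [o|P f phi hP fP]; rewrite -lincombA.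
  have [ho _ _] := op_spec o hH eH.
  have gH' : g \in edges (op_pack o e) by rewrite !inE ge.
  rewrite (Qw_rec w ho gH'); apply: eq_lincomb => o'.
  by rewrite op_packC // 1?eq_sym //; case: (FP o').
have gS : inr g \in edges (two_sum f e phi) by rewrite sum_edger ge.
rewrite (Qw_rec w (two_sum_axioms phi hP hH fP eH) gS); apply: eq_lincomb => o.
by rewrite op_two_sumr //; case: (FP o) => _; apply.
Qed.

(** Interpolates between [Qw w] and [Qw F]: the edges listed in [s] are expanded with [F], the
    remaining ones with [w]. *)
Fixpoint mixed (L : Type) (F : operation -> K) (s : seq L) (P : packaged)
    (iota : L -> label P) : K :=
  if s is f :: s' then
    lincomb F (fun o => @mixed L F s' (op_pack o (iota f)) iota)
  else Q P.

Lemma eq_mixed L F s (A : arrow_pres) (E1 E2 : {set label A})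
    (c1 c2 : {ffun point A -> point A}) (v1 v2 b1 b2 : {set {set {set point A}}}) iota :
    [/\ E1 = E2, c1 = c2, v1 = v2 & b1 = b2] ->
  @mixed L F s (repack E1 c1 v1 b1) iota = @mixed L F s (repack E2 c2 v2 b2) iota.
Proof. by case=> -> -> -> ->. Qed.

Section Mixed.
Variables (H : packaged) (e : label H) (F : operation -> K).
Hypotheses (hH : packaged_axioms H) (eH : e \in edges H) (FP : edge_coef e F).

(** The edges expanded with [F] differ from [f], so these expansions pass through the 2-sum at [f],
    and the rule of [edge_coef] applies at the end. *)
Lemma mixed_two_sum (L : eqType) (s : seq L) (P : packaged) (iota : L -> label P)
    (f : label P) phi :
    packaged_axioms P -> f \in edges P -> uniq (map iota s) ->
    {subset map iota s <= edges P} -> f \notin map iota s ->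
  @mixed L F s (two_sum f e phi) (fun g => inl (iota g)) =
  lincomb F (fun o => @mixed L F s (op_pack o f) iota).
Proof.
elim: s P iota f => [|g s IHs] P iota f hP fP /=; first by move=> _ _ _; case: FP => _; apply.
case/andP=> gs us sP; rewrite inE negb_or => /andP[fg fs].
have gP : iota g \in edges P by apply: sP; rewrite mem_head.
rewrite lincombC; apply: eq_lincomb => o.
have gf : iota g != f by rewrite eq_sym.
have [hg _ _] := op_spec o hP gP.
transitivity (@mixed L F s (@two_sum (op_pack o (iota g)) H f e phi) (fun g => inl (iota g))).
  exact: eq_mixed (op_two_suml_components o phi hP hH fP eH gP gf).
rewrite (IHs (op_pack o (iota g)) iota f) //.
- by apply: eq_lincomb => o'; apply: eq_mixed (op_pack_components o o' hP gP fP gf).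
- by rewrite !inE fg.
move=> l ls; rewrite !inE sP ?inE ?ls ?orbT // andbT.
by apply: contraNneq gs => <-.
Qed.

Lemma Q_two_sums (L : finType) (phi : L -> {perm bool}) (s : seq L) (P : packaged)
    (iota : L -> label P) :
    packaged_axioms P -> uniq (map iota s) -> {subset map iota s <= edges P} ->
  Q (@two_sums L H e phi s P iota) = mixed F s iota.
Proof.
elim: s P iota => //= f s IHs P iota hP /andP[fs us] sP.
have fP : iota f \in edges P by apply: sP; rewrite mem_head.
have sP' : {subset map iota s <= edges P}.
  by move=> l ls; apply: sP; rewrite inE ls orbT.
rewrite IHs ?mixed_two_sum //; first exact: two_sum_axioms.
- by rewrite (map_comp inl) map_inj_uniq //; apply: inl_inj.
move=> l; rewrite (map_comp inl) => /mapP[g gs ->].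
by rewrite sum_edgel sP' // andbT; apply: contraNneq fs => <-.
Qed.

Lemma mixed_all (P : packaged) (s : seq (label P)) :
  packaged_axioms P -> perm_eq s (enum (edges P)) -> mixed F s id = Qw F P.
Proof.
have gen (L : finType) (t : seq L) : forall (R : packaged) (iota : L -> label R),
    packaged_axioms R -> uniq (map iota t) -> map iota t =i edges R ->
    mixed F t iota = Qw F R.
  elim: t => [|f t IHt] R iota hR /= ut st.
    have E0 : edges R = set0 by apply/setP=> l; rewrite -st !inE.
    by rewrite !Qw_edgeless.
  have fR : iota f \in edges R by rewrite -st mem_head.
  rewrite (Qw_rec F hR fR); apply: eq_lincomb => o; case/andP: ut => ft ut.
  have [hf _ _] := op_spec o hR fR; apply: IHt => // l.
  rewrite !inE -st inE; case: eqVneq => //= ->; exact: negbTE.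
move=> hP sE; apply: gen => // [|l]; rewrite map_id ?(perm_uniq sE) ?enum_uniq //.
by rewrite (perm_mem sE) mem_enum.
Qed.

End Mixed.
End Coefficients.
End TensorPolynomial.

(** The 25 entries of the matrix are the values of [pairing], in the order [Del], [Con], [Pen],
    [DelM], [ConM]. *)
Lemma tensor_mx_pairing (K : comNzRingType) (alpha beta gamma : K) (F : operation -> K) :
  tensor_mx alpha beta gamma *m col5 [:: F Del; F Con; F Pen; F DelM; F ConM] =
  let G o := lincomb F (pairing alpha beta gamma o) in
  col5 [:: G Del; G Con; G Pen; G DelM; G ConM].
Proof.
apply/colP=> i; rewrite !mxE !big_ord_recl big_ord0 !mxE /= /lincomb.
case: i => -[|[|[|[|[|//]]]]] lti /=; rewrite /pairing /=; ring.
Qed.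

Theorem theorem3p3 (K : fieldType) (a b c x y alpha beta gamma : K)
  (P H : packaged) (e : label H) (phi : label P -> {perm bool})
  (s : seq (label P)) (phi_eq2 phi_par2 phi_cross phi_eq1 phi_par1 : K) :
  packaged_axioms P ->
  packaged_axioms H ->
  e \in edges H ->
  perm_eq s (enum (edges P)) ->
  unique
    (fun sol : 'cV[K]_5 =>
       tensor_mx alpha beta gamma *m sol =
       col5 [:: Q_poly a b c x y alpha beta gamma (pdelete e);
                Q_poly a b c x y alpha beta gamma (pcontract e);
                Q_poly a b c x y alpha beta gamma (ppenrose e);
                Q_poly a b c x y alpha beta gamma (pdelete_m e);
                Q_poly a b c x y alpha beta gamma (pcontract_m e)])
    (col5 [:: phi_eq2; phi_par2; phi_cross; phi_eq1; phi_par1]) ->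
  Q_poly a b c x y alpha beta gamma (tensor e phi s) =
  Q_poly phi_eq2 phi_par2 phi_cross phi_eq1 phi_par1 alpha beta gamma P.
Proof.
move=> hP hH eH sE [_ sol_unique].
pose w o := match o with Del => a | Con => b | Pen => c | DelM => x | ConM => y end.
have [F FP] := edge_coefP alpha beta gamma w hH eH.
(* [F] solves the system by the first condition of [edge_coef], so uniqueness identifies it with the
   given solution. *)
have FE : col5 [:: phi_eq2; phi_par2; phi_cross; phi_eq1; phi_par1] =
    col5 [:: F Del; F Con; F Pen; F DelM; F ConM].
  by apply: sol_unique; rewrite tensor_mx_pairing /= -!FP.1.
have Fi i (lti : (i < 5)%N) : nth 0 [:: phi_eq2; phi_par2; phi_cross; phi_eq1; phi_par1] i =
    nth 0 [:: F Del; F Con; F Pen; F DelM; F ConM] i.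
  by move/colP/(_ (Ordinal lti)): FE; rewrite !mxE.
transitivity (Qw alpha beta gamma F P).
  rewrite -(mixed_all alpha beta gamma w F hP sE).
  apply: (Q_two_sums hH eH FP phi (iota := id)); rewrite ?map_id //; last first.
    by move=> l; rewrite (perm_mem sE) mem_enum.
  by rewrite (perm_uniq sE) enum_uniq.
by move: (Fi 0%N isT) (Fi 1%N isT) (Fi 2%N isT) (Fi 3%N isT) (Fi 4%N isT) => /= -> -> -> -> ->.
Qed.
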